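(* Let $\Lambda$ be a rhombic lattice satisfying the standing assumptions, let $\mathcal H(\Lambda)$ be the space of discrete analytic (DA) functions on $\Lambda$, let $Z_-$ be the backward shift operator on $\mathcal H(\Lambda)$, and let $$\mathbf S(\Lambda)=\{t\in\mathbb C: 2+t(1-e)=0\text{ for some }e\in\hat{\mathbf E}(\Lambda)\}.$$ (1) Every $t\in\mathbb C\setminus\mathbf S(\Lambda)$ is an eigenvalue of the operator $Z_-$ (acting on complex-valued DA functions). The corresponding eigenspace is one-dimensional; it is spanned by the DA function $e_t(z)$ determined as follows: $e_t(0)=1$, and $$e_t(z)=\prod_{k=1}^N\frac{2+t(1+z_k-z_{k-1})}{2+t(1+z_{k-1}-z_k)}$$ for $z\neq 0$, where $(z_0,z_1,\dots,z_N)$ is any path in $\Lambda$ from $z_0=0$ to $z_N=z$. (2) If $t\in\mathbf S(\Lambda)$, then the operator $tI-Z_-$ is a bijection from $\mathcal H(\Lambda)$ to itself (where the DA functions take values in an arbitrary complex vector space $\mathcal V$).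
   Context: Rhombic lattice: $\Lambda$ is a monohedral (edge-to-edge) tessellation of $\mathbb C$ by mutually congruent (nondegenerate) rhombi of side length 1, viewed as a planar graph with vertex set $\mathbf V(\Lambda)$, (undirected) edge set $\mathbf E(\Lambda)$ and face set $\mathbf F(\Lambda)$ (the rhombi). $\hat{\mathbf E}(\Lambda)=\{b-a:(a,b)\in\mathbf E(\Lambda)\}$ is the set of edge directions; it is finite and closed under $e\mapsto -e$. A path from $a$ to $b$ is a finite sequence $(z_0=a,z_1,\dots,z_N=b)$ of vertices with consecutive ones adjacent; it is closed if $a=b$. Standing assumptions: $0\in\mathbf V(\Lambda)$; $1\in\hat{\mathbf E}(\Lambda)$; and both sides of every track $F$ in $\Lambda$ contain tracks that are coherent to $F$. Here a track is a sequence $(F_n)_{n\in\mathbb Z}$ of faces such that for every $n$ the faces $F_n,F_{n+1}$ are adjacent and the edges shared by $F_n$ with $F_{n+1}$ and with $F_{n-1}$ are two opposite sides of $F_n$; these shared edges are the ties of the track. The sides of a track are the two connected components of the graph obtained by deleting all ties of the track from $\mathbf E(\Lambda)$. Two tracks are coherent if their ties are parallel. DA functions: for $f:\mathbf V(\Lambda)\to\mathcal V$ ($\mathcal V$ a complex vector space) and a path $\gamma=(z_0,\dots,z_N)$, $\int_\gamma f\,\delta z=\sum_{n=1}^N\frac{f(z_{n-1})+f(z_n)}{2}(z_n-z_{n-1})$. $f$ is DA if $\int_\gamma f\,\delta z=0$ for every closed path $\gamma$; $\int_a^b f\,\delta z$ denotes the then path-independent integral along any path from $a$ to $b$. $\mathcal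 H(\Lambda)$ is the space of DA functions. Shifts: the forward shift $Z_+:\mathcal H(\Lambda)\to\mathcal H(\Lambda)$ is $(Z_+f)(z)=\frac{f(0)-f(z)}{2}+\int_0^z f\,\delta z$. It is injective with range $\{f\in\mathcal H(\Lambda): f(0)=0\}$. The backward shift $Z_-:\mathcal H(\Lambda)\to\mathcal H(\Lambda)$ assigns to $g$ the unique $Z_-g\in\mathcal H(\Lambda)$ with $(Z_+Z_-g)(z)=g(z)-g(0)$. *)

(* Defs.v *)
From HB Require Import structures.
From mathcomp Require Import all_boot all_order all_algebra.
From mathcomp Require Import all_classical all_reals.
From mathcomp.real_closed Require Export complex.

Set Implicit Arguments.
Unset Strict Implicit.
Unset Printing Implicit Defensive.

Import Order.TTheory GRing.Theory Num.Theory.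

Local Open Scope classical_set_scope.
Local Open Scope ring_scope.
Local Open Scope complex_scope.

Section PlaneGeometry.
Variable R : realType.
Local Notation C := R[i].
Implicit Types (A B : set C) (a b c d u v z : C).

Definition parallelogram a u v : set C :=
  [set z | exists s t : R,
    [/\ 0 <= s <= 1, 0 <= t <= 1 & z = a + s%:C * u + t%:C * v]].

Definition closed_segment a b : set C :=
  [set z | exists2 s : R, 0 <= s <= 1 & z = a + s%:C * (b - a)].

(* A is the filled rhombus of side 1 with corner a and sides u, v issuing from
   a; two unit vectors are non-parallel iff they are neither equal nor
   opposite. *)
Definition rhombus A a u v : Prop :=
  [/\ `|u| = 1, `|v| = 1, v <> u, v <> - u & A = parallelogram a u v].

(* Any of the four corners of A may play the role of a, and the two sides at a
   may be listed in either order, so all four sides are obtained, in both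
   orientations. *)
Definition rhombus_side A a b : Prop := exists v, rhombus A a (b - a) v.

Definition rhombus_corner A a : Prop := exists b, rhombus_side A a b.

Definition opposite_sides A a b c d : Prop :=
  exists2 v, rhombus A a (b - a) v &
    (c = a + v /\ d = b + v) \/ (c = b + v /\ d = a + v).

Definition congruent_sets A B : Prop :=
  exists2 g : C -> C, (forall z w, `|g z - g w| = `|z - w|) & g @` A = B.

Definition parallel u v : Prop := exists r : R, v = r%:C * u.

End PlaneGeometry.

(* The tiles are filled closed rhombi. The last field says that the tiling is
   edge-to-edge; it implies that distinct tiles have disjoint interiors. *)
Record rhombic_lattice (R : realType) := RhombicLattice {
  faces : set (set R[i]);
  faces_rhombus : forall A, faces A -> exists a u v, rhombus A a u v;
  faces_congruent : forall A B, faces A -> faces B -> congruent_sets A B;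
  faces_cover : forall z : R[i], exists2 A, faces A & A z;
  faces_edge_to_edge : forall A B, faces A -> faces B -> A <> B ->
    [\/ A `&` B = set0,
        exists a, [/\ rhombus_corner A a, rhombus_corner B a
                    & A `&` B = [set a]]
      | exists a b, [/\ rhombus_side A a b, rhombus_side B a b
                    & A `&` B = closed_segment a b]]
}.

Section Lattice.
Variables (R : realType) (L : rhombic_lattice R).
Local Notation C := R[i].

Definition vertices : set C :=
  [set a | exists2 A, faces L A & rhombus_corner A a].

Definition edge (a b : C) : Prop := exists2 A, faces L A & rhombus_side A a b.

Definition edge_directions : set C :=
  [set e | exists a b, edge a b /\ e = b - a].

(* A walk is (z 0, ..., z N); the values z k for k > N are irrelevant. *)
Definition walk (E : C -> C -> Prop) (N : nat) (z : nat -> vertices) : Prop :=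
  forall k, (k < N)%N -> E (val (z k)) (val (z k.+1)).

Definition path_from_to (a b : vertices) (N : nat) (z : nat -> vertices) :
  Prop := [/\ z 0%N = a, z N = b & walk edge N z].

Definition common_side (A B : set C) (a b : C) : Prop :=
  rhombus_side A a b /\ rhombus_side B a b.

Definition adjacent_faces (A B : set C) : Prop :=
  A <> B /\ exists a b, common_side A B a b.

Definition track (F : int -> set C) : Prop :=
  forall n : int,
    [/\ faces L (F n), adjacent_faces (F n) (F (n + 1))
      & forall a b c d,
          common_side (F (n - 1)) (F n) a b ->
          common_side (F n) (F (n + 1)) c d ->
          opposite_sides (F n) a b c d].

Definition tie (F : int -> set C) (a b : C) : Prop :=
  exists n : int, common_side (F n) (F (n + 1)) a b.

Definition coherent (F G : int -> set C) : Prop :=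
  forall a b c d, tie F a b -> tie G c d -> parallel (b - a) (d - c).

Definition track_side (F : int -> set C) (K : set vertices) : Prop :=
  exists c : vertices,
    K = [set x | exists N z, [/\ z 0%N = c, z N = x
                               & walk (fun a b => edge a b /\ ~ tie F a b) N z]].

Definition side_contains_track (K : set vertices) (G : int -> set C) : Prop :=
  forall (n : int) (x : vertices), rhombus_corner (G n) (val x) -> K x.

Definition coherent_tracks_on_both_sides : Prop :=
  forall F, track F -> forall K, track_side F K ->
    exists G, [/\ track G, side_contains_track K G & coherent F G].

Definition origin (h0 : vertices 0) : vertices := exist _ 0 (mem_set h0).

Section Functions.
Variable V : lmodType C.
Implicit Types f g h : vertices -> V.

Definition path_integral f (N : nat) (z : nat -> vertices) : V :=
  \sum_(k < N)
    (val (z k.+1) - val (z k)) *: (2^-1 *: (f (z k) + f (z k.+1))).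

Definition DA : set (vertices -> V) :=
  [set f | forall a N z, path_from_to a a N z -> path_integral f N z = 0].

(* The common value of the path integrals when f is DA. *)
Definition integral f (a b : vertices) : V :=
  xget 0 [set I | exists N z, path_from_to a b N z /\ I = path_integral f N z].

Variable h0 : vertices 0.
Local Notation o := (origin h0).

Definition Zplus f : vertices -> V :=
  fun z => 2^-1 *: (f o - f z) + integral f o z.

(* The unique DA preimage of g - g(0) under Zplus when g is DA. *)
Definition Zminus g : vertices -> V :=
  xget 0 [set h | DA h /\ Zplus h = (fun z => g z - g o)].

Definition Zminus_eigenspace (t : C) : set (vertices -> V) :=
  [set f | DA f /\ Zminus f = t *: f].

Definition Zminus_eigenvalue (t : C) : Prop :=
  exists2 f, Zminus_eigenspace t f & f <> 0.

End Functions.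

Definition singular_set : set C :=
  [set t | exists2 e, edge_directions e & 2 + t * (1 - e) = 0].

Definition exp_product (t : C) (N : nat) (z : nat -> vertices) : C :=
  \prod_(k < N) ((2 + t * (1 + val (z k.+1) - val (z k))) /
                 (2 + t * (1 + val (z k) - val (z k.+1)))).

Definition discrete_exp (h0 : vertices 0) (t : C) (e : vertices -> C^o) :
  Prop :=
  e (origin h0) = 1 /\
  forall x N z, val x <> 0 -> path_from_to (origin h0) x N z ->
    e x = exp_product t N z.

End Lattice.

Arguments DA {R} L V _.
Arguments Zminus_eigenspace {R L} V h0 t _.
Arguments Zminus_eigenvalue {R L} V h0 t.

Definition span1 (K : pzRingType) (W : lmodType K) (w : W) : set W :=
  [set v | exists c : K, v = c *: w].

Definition one_dimensional (K : pzRingType) (W : lmodType K) (E : set W) :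
  Prop := exists2 w, w <> 0 & E = span1 w.

(* Main.v *)
(* A closed 1-cochain on the edges of the tiling is exact: on a rectangle
   meeting only faces with a common corner this is clear, rectangles can be
   glued along a side, and a Cousin (bisection) argument then reaches all
   rectangles.  The same holds for cochains valued in the bijections of a set,
   which is the form used here (monodromy).

   Summed along an edge from a to b, d = b - a, the equation Z_- f = t f reads
   (2 + t (1 + d)) f(a) = (2 + t (1 - d)) f(b).  For t outside S it propagates
   along edges with trivial monodromy, and its solution e_t is DA because
   t d (e_t(a) + e_t(b)) = (2 + t) (e_t(b) - e_t(a)).

   For t in S, write 2 + t = t e with e an edge direction.  Then t f - Z_- f = g
   becomes (e + d) f(a) - (e - d) f(b) = G(b) - G(a) with G = (2/t) Z_+ g, and
   Z_- itself is the case e = 1.  Here f(a) is forced at the lower end of each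
   tie (a, a + e) and propagates along the other edges.  The level n, which
   increases by one along e and is constant along the other edges, is
   nondecreasing on lines parallel to e.  Hence two ties of the same level lie
   on the same track, along which the forced values are consistent (existence).
   By the standing assumption there are ties of arbitrarily high level, so
   climbing from any vertex along e one meets the track bounding its strip from
   above, and the forced values determine f (uniqueness). *)

Require Import Defs.
From mathcomp Require Import all_boot all_order all_algebra.
From mathcomp Require Import all_classical all_reals.
From mathcomp Require Import ring lra.

Set Implicit Arguments.
Unset Strict Implicit.
Unset Printing Implicit Defensive.

Import Order.TTheory GRing.Theory Num.Theory.

Local Open Scope classical_set_scope.
Local Open Scope ring_scope.
Local Open Scope complex_scope.

(** A lattice is given only as a family of point sets, so finiteness has to be derived: congruence
    bounds the areas of the faces from below, disjoint interiors then leave finitely many faces near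
    any point, and every passage from face to face along a line rests on this. For t in S the edge
    equation degenerates exactly on the ties, where one of its two coefficients vanishes. Values
    propagate naturally only inside a strip between two tracks, whose topology would have to be
    studied. This is avoided: an artificial translation is attached to each tie, chosen so that the
    transport is defined on all edges and flat on all faces, and monodromy on the whole plane
    applies. The translations do not enter the equation to be solved, since the two ends of a tie
    have different levels and take their values from different sections. *)

Section ComplexCoordinates.
Variable R : realType.
Local Notation C := R[i].
Implicit Types (u v z w a : C) (s t : R).

(** The signed area spanned by u and v; [dt] below is their scalar product. *)
Definition cr u v : R := complex.Re u * complex.Im v - complex.Im u * complex.Re v.
Definition dt u v : R := complex.Re u * complex.Re v + complex.Im u * complex.Im v.

Lemma complex_eq z w :
  complex.Re z = complex.Re w -> complex.Im z = complex.Im w -> z = w.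
Proof. by case: z => [? ?]; case: w => [? ?] /= -> ->. Qed.

Lemma ReD z w : complex.Re (z + w) = complex.Re z + complex.Re w.
Proof. by case: z => [? ?]; case: w. Qed.
Lemma ImD z w : complex.Im (z + w) = complex.Im z + complex.Im w.
Proof. by case: z => [? ?]; case: w. Qed.
Lemma ReN z : complex.Re (- z) = - complex.Re z.
Proof. by case: z. Qed.
Lemma ImN z : complex.Im (- z) = - complex.Im z.
Proof. by case: z. Qed.
Lemma ReZ s z : complex.Re (s%:C * z) = s * complex.Re z.
Proof. by case: z => [? ?] /=; rewrite mul0r subr0. Qed.
Lemma ImZ s z : complex.Im (s%:C * z) = s * complex.Im z.
Proof. by case: z => [? ?] /=; rewrite mul0r addr0. Qed.

Definition ReImE := (ReD, ImD, ReN, ImN, ReZ, ImZ).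

Lemma unit_normP u : `|u| = 1 <-> dt u u = 1.
Proof.
rewrite normc_def /dt -!expr2; split=> [[h]|->]; last by rewrite sqrtr1.
by rewrite -[LHS]sqr_sqrtr ?h ?expr1n// addr_ge0 ?sqr_ge0.
Qed.

Lemma cr_dt u v : cr u v ^+ 2 + dt u v ^+ 2 = dt u u * dt v v.
Proof. rewrite /cr /dt; ring. Qed.

Lemma unit_cr_neq0 u v : `|u| = 1 -> `|v| = 1 -> v <> u -> v <> - u ->
  cr u v != 0.
Proof.
move=> /unit_normP hu /unit_normP hv hn hN; apply/eqP => h.
have := cr_dt u v; rewrite h hu hv mul1r expr0n add0r => /eqP.
have hr : complex.Re v = dt u v * complex.Re u.
  rewrite -[LHS]mul1r -hu -[RHS]subr0 -(mul0r (complex.Im u)) -h /dt /cr; ring.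
have hi : complex.Im v = dt u v * complex.Im u.
  rewrite -[LHS]mul1r -hu -[RHS]addr0 -(mul0r (complex.Re u)) -h /dt /cr; ring.
rewrite sqrf_eq1 => /orP[] /eqP hd; [apply: hn|apply: hN]; apply: complex_eq;
by rewrite ?ReImE ?hr ?hi hd ?mul1r ?mulN1r.
Qed.

Lemma crZl s u v : cr (s%:C * u) v = s * cr u v.
Proof. by rewrite /cr !ReImE; ring. Qed.
Lemma crZr s u v : cr u (s%:C * v) = s * cr u v.
Proof. by rewrite /cr !ReImE; ring. Qed.
Lemma crDl u v w : cr (u + v) w = cr u w + cr v w.
Proof. by rewrite /cr !ReImE; ring. Qed.
Lemma crDr u v w : cr u (v + w) = cr u v + cr u w.
Proof. by rewrite /cr !ReImE; ring. Qed.
Lemma crNl u v : cr (- u) v = - cr u v.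
Proof. by rewrite /cr !ReImE; ring. Qed.
Lemma crNr u v : cr u (- v) = - cr u v.
Proof. by rewrite /cr !ReImE; ring. Qed.
Lemma crC u v : cr u v = - cr v u.
Proof. by rewrite /cr; ring. Qed.
Lemma crxx u : cr u u = 0.
Proof. by rewrite /cr; ring. Qed.

Definition crE := (crDl, crDr, crNl, crNr, crZl, crZr, crxx).

Lemma cross_coord u v s t s' t' : cr u v != 0 ->
  s%:C * u + t%:C * v = s'%:C * u + t'%:C * v -> s = s' /\ t = t'.
Proof.
move=> h H; split; apply: (mulIf h).
  by have := congr1 (fun z => cr z v) H; rewrite !crE !mulr0 !addr0.
by have := congr1 (cr u) H; rewrite !crE !mulr0 !add0r.
Qed.

(** Cramer's rule. *)
Lemma cr_basis u v z : cr u v != 0 ->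
  z = (cr z v / cr u v)%:C * u + (cr u z / cr u v)%:C * v.
Proof. by move=> h; apply: complex_eq; rewrite !ReImE /cr in h *; field. Qed.


End ComplexCoordinates.

(** * Corners and sides of a rhombus, as invariants of the point set *)

Section Rhombi.
Variable R : realType.
Local Notation C := R[i].
Implicit Types (A B : set C) (a b c u v w z : C) (s t : R).

Lemma rhombus_cr A a u v : rhombus A a u v -> cr u v != 0.
Proof. by case=> hu hv h1 h2 _; apply: unit_cr_neq0. Qed.

Lemma rhombus_neq0 A a u v : rhombus A a u v -> u != 0.
Proof. by case=> hu _ _ _ _; apply: contra_eqN hu => /eqP ->; rewrite normr0 eq_sym oner_eq0. Qed.

Lemma rhombus_mem A a u v s t : rhombus A a u v -> 0 <= s <= 1 -> 0 <= t <= 1 ->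
  A (a + s%:C * u + t%:C * v).
Proof. by case=> _ _ _ _ -> hs ht; exists s, t. Qed.

Lemma rhombus_memP A a u v z : rhombus A a u v -> A z ->
  exists s t, [/\ 0 <= s <= 1, 0 <= t <= 1 & z = a + s%:C * u + t%:C * v].
Proof. by case=> _ _ _ _ ->. Qed.

Lemma rhombus_swap A a u v : rhombus A a u v -> rhombus A a v u.
Proof.
case=> hu hv h1 h2 ->; split=> //; first by move=> h; apply: h1.
  by move=> h; apply: h2; rewrite h opprK.
by apply/seteqP; split=> z [s [t [hs ht ->]]]; exists t, s; split=> //; rewrite addrAC.
Qed.

Lemma rhombus_flip A a u v : rhombus A a u v -> rhombus A (a + u) (- u) v.
Proof.
case=> hu hv h1 h2 ->; split=> //; rewrite ?normrN ?opprK//.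
apply/seteqP; split=> z [s [t [/andP[hs hs'] ht ->]]]; exists (1 - s), t;
  (split; [by apply/andP; split; lra|by []|]); apply: complex_eq; rewrite !ReImE; ring.
Qed.

Lemma rhombus_base A a u v : rhombus A a u v -> A a.
Proof.
move=> h; have := rhombus_mem (s := 0) (t := 0) h.
by rewrite !mul0r !addr0; apply; rewrite lexx ler01.
Qed.

Lemma rhombus_extremal A a u v w : rhombus A a u v -> A (a + w) -> A (a - w) ->
  w = 0.
Proof.
move=> h /(rhombus_memP h) [s [t [/andP[hs _] /andP[ht _] h1]]].
move=> /(rhombus_memP h) [s' [t' [/andP[hs' _] /andP[ht' _] h2]]].
have e1 : w = s%:C * u + t%:C * v by apply: (addrI a); rewrite h1 addrA.
have e2 : - w = s'%:C * u + t'%:C * v by apply: (addrI a); rewrite h2 addrA.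
have : (s + s')%:C * u + (t + t')%:C * v = 0%:C * u + 0%:C * v.
  rewrite rmorphD rmorphD /= !mulrDl addrACA -e1 -e2 subrr !mul0r addr0 //.
move=> /(cross_coord (rhombus_cr h)) [hss htt].
have t0 : t = 0 by lra.
have s0 : s = 0 by lra.
by rewrite e1 s0 t0 !mul0r addr0.
Qed.

(** A corner is an extreme point of A by [rhombus_extremal], whereas a point with a coordinate
    strictly between 0 and 1 is the midpoint of a segment in A. So corners depend on the set only,
    not on its presentation. *)
Lemma rhombus_corner4 A a u v a' u' v' : rhombus A a u v -> rhombus A a' u' v' ->
  [\/ a' = a, a' = a + u, a' = a + v | a' = a + u + v].
Proof.
move=> h h'.
have inner x y b s t : rhombus A b x y -> 0 <= s <= 1 -> 0 <= t <= 1 ->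
    a' = b + s%:C * x + t%:C * y -> s = 0 \/ s = 1.
  move=> hr /andP[s0 s1] ht e.
  have [/eqP ?|sn0] := boolP (s == 0); first by left.
  have [/eqP ?|sn1] := boolP (s == 1); first by right.
  have {sn0}s0 : 0 < s by rewrite lt_def sn0.
  have {sn1}s1 : s < 1 by rewrite lt_def eq_sym sn1.
  pose d := Num.min s (1 - s).
  have d0 : 0 < d by rewrite lt_min s0 subr_gt0.
  have ds : d <= s by rewrite ge_min lexx.
  have ds' : d <= 1 - s by rewrite ge_min lexx orbT.
  have /eqP : d%:C * x = 0.
    apply: (rhombus_extremal h').
      have -> : a' + d%:C * x = b + (s + d)%:C * x + t%:C * y.
        by rewrite e; apply: complex_eq; rewrite !ReImE; ring.
      by apply: rhombus_mem => //; apply/andP; split; lra.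
    have -> : a' - d%:C * x = b + (s - d)%:C * x + t%:C * y.
      by rewrite e; apply: complex_eq; rewrite !ReImE; ring.
    by apply: rhombus_mem => //; apply/andP; split; lra.
  by rewrite mulf_eq0 (negPf (rhombus_neq0 hr)) orbF fmorph_eq0 gt_eqF.
have [s [t [hs ht e]]] := rhombus_memP h (rhombus_base h').
have e' : a' = a + t%:C * v + s%:C * u by rewrite e addrAC.
have [s0|s1] := inner _ _ _ _ _ h hs ht e;
  have [t0|t1] := inner _ _ _ _ _ (rhombus_swap h) ht hs e'; rewrite e ?s0 ?s1 ?t0 ?t1.
- by apply: Or41; rewrite !mul0r !addr0.
- by apply: Or43; rewrite mul0r addr0 mul1r.
- by apply: Or42; rewrite mul0r addr0 mul1r.
- by apply: Or44; rewrite !mul1r.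
Qed.

(** The vectors u', v' and u' + v' all lead from a to corners, so their coordinates in the basis u,
    v are 0 or 1; independence of u' and v' leaves only the two orders. *)
Lemma rhombus_based A a u v u' v' : rhombus A a u v -> rhombus A a u' v' ->
  (u' = u /\ v' = v) \/ (u' = v /\ v' = u).
Proof.
move=> h h'.
have cN := rhombus_cr h.
have coord (x : C) : [\/ x = 0, x = u, x = v | x = u + v] ->
    exists s t, [/\ s = 0 \/ s = 1, t = 0 \/ t = 1 & x = s%:C * u + t%:C * v].
  case=> ->; [exists 0, 0|exists 1, 0|exists 0, 1|exists 1, 1]; split; auto;
  by rewrite ?mul0r ?mul1r ?addr0 ?add0r.
have shift (x y z : C) : rhombus A (a + x) y z -> [\/ x = 0, x = u, x = v | x = u + v].
  move=> /(rhombus_corner4 h) [e|e|e|e]; [apply: Or41|apply: Or42|apply: Or43|apply: Or44];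
  by apply: (addrI a); rewrite e ?addr0 ?addrA.
have h1 := rhombus_flip h'.
have h2 := rhombus_flip (rhombus_swap h').
have h3 := rhombus_flip (rhombus_swap h1).
rewrite -addrA in h3.
have [s1 [t1 [S1 T1 e1]]] := coord _ (shift _ _ _ h1).
have [s2 [t2 [S2 T2 e2]]] := coord _ (shift _ _ _ h2).
have [s3 [t3 [S3 T3 e3]]] := coord _ (shift _ _ _ h3).
have : s3%:C * u + t3%:C * v = (s1 + s2)%:C * u + (t1 + t2)%:C * v.
  by rewrite -e3 e1 e2 !rmorphD /= !mulrDl addrACA.
move=> /(cross_coord cN) [es et].
have cN' := rhombus_cr h'; rewrite e1 e2 !crE (crC v u) in cN'.
have [[a1 b1 a2 b2]|[a1 b1 a2 b2]] : [/\ s1 = 1, t1 = 0, s2 = 0 & t2 = 1] \/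
    [/\ s1 = 0, t1 = 1, s2 = 1 & t2 = 0].
- have {}cN' : s1 * t2 - s2 * t1 != 0.
    apply: contra_neq cN' => h0; transitivity ((s1 * t2 - s2 * t1) * cr u v); first by ring.
    by rewrite h0 mul0r.
  clear -S1 S2 S3 T1 T2 T3 es et cN'.
  case: S1 es cN' => ->; case: S2 => ->; case: S3 => -> es; case: T1 et => ->;
    case: T2 => ->; case: T3 => -> et cN';
    try (by left; split); try (by right; split); exfalso; move/eqP: cN' => cN';
    try lra; apply: cN'; lra.
- by left; rewrite e1 e2 a1 a2 b1 b2 !mul0r !mul1r addr0 add0r.
- by right; rewrite e1 e2 a1 a2 b1 b2 !mul0r !mul1r addr0 add0r.
Qed.

Lemma rhombus_reps A a u v a' u' v' : rhombus A a u v -> rhombus A a' u' v' ->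
  [\/ a' = a, a' = a + u, a' = a + v | a' = a + u + v] /\
  exists x y, [/\ rhombus A a' x y, (u' = x /\ v' = y) \/ (u' = y /\ v' = x) &
   [\/ [/\ a' = a, x = u & y = v], [/\ a' = a + u, x = - u & y = v],
       [/\ a' = a + v, x = u & y = - v] | [/\ a' = a + u + v, x = - u & y = - v]]].
Proof.
move=> h h'; have hc := rhombus_corner4 h h'; split=> //.
have h1 := rhombus_flip h.
have h2 := rhombus_swap (rhombus_flip (rhombus_swap h)).
have h3 := rhombus_swap (rhombus_flip (rhombus_swap h1)).
by case: hc => e; subst a'; [exists u, v|exists (- u), v|exists u, (- v)|exists (- u), (- v)];
  (split=> //; [exact: rhombus_based h'|]);
  [apply: Or41|apply: Or42|apply: Or43|apply: Or44].
Qed.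

(** The outer disjunction separates the sides parallel to u from those parallel to v. *)
Lemma rhombus_sideP A a u v c d : rhombus A a u v -> rhombus_side A c d ->
  [\/ [/\ c = a & d = a + u], [/\ c = a + u & d = a], [/\ c = a + v & d = a + u + v]
    | [/\ c = a + u + v & d = a + v]] \/
  [\/ [/\ c = a & d = a + v], [/\ c = a + v & d = a], [/\ c = a + u & d = a + u + v]
    | [/\ c = a + u + v & d = a + u]].
Proof.
move=> h [w h'].
have ed : d = c + (d - c) by rewrite addrC subrK.
have [_ [x [y [_ hxy hc]]]] := rhombus_reps h h'.
case: hxy => -[e _]; rewrite e in ed; case: hc => -[ec ex ey];
rewrite ec ?ex ?ey in ed; rewrite ec ed ?addrK.
- by left; apply: Or41.
- by left; apply: Or42.
- by left; apply: Or43; split=> //; rewrite addrAC.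
- by left; apply: Or44; split=> //; rewrite addrAC addrK.
- by right; apply: Or41.
- by right; apply: Or43.
- by right; apply: Or42.
- by right; apply: Or44.
Qed.
End Rhombi.

(** * How faces meet at a point *)

Section Faces.
Variable R : realType.
Local Notation C := R[i].
Implicit Types (A B : set C) (a b c d p q u v w z : C) (r s t : R).

Definition box p r z : Prop :=
  `|complex.Re (z - p)| < r /\ `|complex.Im (z - p)| < r.

Lemma dt_norm z : (dt z z)%:C = `|z| ^+ 2.
Proof. by rewrite -add_Re2_Im2 /dt !expr2. Qed.

Lemma unit_coord_le1 u : `|u| = 1 ->
  `|complex.Re u| <= 1 /\ `|complex.Im u| <= 1.
Proof.
move=> /unit_normP; rewrite /dt -!expr2 => h.
by split; rewrite ler_norml; apply/andP; split; nra.
Qed.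

Lemma cr_box_lt p r z v : `|v| = 1 -> box p r z -> `|cr (z - p) v| < 2 * r.
Proof.
move=> /unit_coord_le1[h1 h2] [h3 h4]; rewrite /cr.
apply: le_lt_trans (ler_normB _ _) _; rewrite !normrM.
have := normr_ge0 (complex.Re v); have := normr_ge0 (complex.Im v).
have := normr_ge0 (complex.Re (z - p)); have := normr_ge0 (complex.Im (z - p)).
nra.
Qed.

Lemma rhombus_coordP A a u v z : rhombus A a u v ->
  A z <-> 0 <= cr (z - a) v / cr u v <= 1 /\ 0 <= cr u (z - a) / cr u v <= 1.
Proof.
move=> h; have c0 := rhombus_cr h.
split=> [/(rhombus_memP h)[s [t [hs ht ->]]]|[hs ht]].
  have -> : a + s%:C * u + t%:C * v - a = s%:C * u + t%:C * v.
    by rewrite addrC !addrA addNr add0r.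
  by rewrite !crE !mulr0 addr0 add0r !mulfK.
rewrite -[z](subrK a) addrC (cr_basis (z - a) c0) addrA.
exact: rhombus_mem.
Qed.

Lemma rhombus_cornerP A a : rhombus_corner A a <-> exists u v, rhombus A a u v.
Proof.
split=> [[b [v h]]|[u [v h]]]; first by exists (b - a), v.
by exists (a + u), v; rewrite addrC addKr.
Qed.

Lemma rhombus_sideC A a b : rhombus_side A a b -> rhombus_side A b a.
Proof.
case=> v /rhombus_flip; rewrite opprB addrC subrK => h; by exists v.
Qed.

Lemma rhombus_side_corner A a b : rhombus_side A a b -> rhombus_corner A a.
Proof. by move=> h; exists b. Qed.

Lemma rhombus_corner_mem A a : rhombus_corner A a -> A a.
Proof. by move=> /rhombus_cornerP[u [v h]]; exact: rhombus_base h. Qed.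

Lemma rhombus_side_mem A a b s : rhombus_side A a b -> 0 <= s <= 1 ->
  A (a + s%:C * (b - a)).
Proof.
move=> [v h] hs; have := rhombus_mem h hs (t := 0).
by rewrite mul0r addr0; apply; rewrite lexx ler01.
Qed.

Lemma rhombus_corners4 A a u v : rhombus A a u v ->
  [/\ rhombus_corner A a, rhombus_corner A (a + u), rhombus_corner A (a + v)
    & rhombus_corner A (a + u + v)].
Proof.
move=> h; have h1 := rhombus_flip h; have h2 := rhombus_flip (rhombus_swap h).
have h3 := rhombus_flip (rhombus_swap h1).
by split; apply/rhombus_cornerP; do 2! eexists; eassumption.
Qed.

Lemma corner_on_side A c d s w : rhombus_corner A w -> rhombus_side A c d ->
  w = c + s%:C * (d - c) -> w = c \/ w = d.
Proof.
move=> /rhombus_cornerP[x [y h']] [v h] e.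
have c0 := rhombus_cr h.
have cd : c + (d - c) = d by rewrite addrC subrK.
have e' k l : w = c + k%:C * (d - c) + l%:C * v -> l = 0.
  rewrite e -addrA => /addrI e1.
  have [_ <-//] : s = k /\ 0 = l.
  by apply: (cross_coord c0); rewrite -e1 mul0r addr0.
have [->|->|ew|ew] := rhombus_corner4 h h'; rewrite ?cd; [by left|by right|exfalso|exfalso].
  have := e' 0 1; rewrite mul0r addr0 mul1r => /(_ ew)/eqP.
  by rewrite oner_eq0.
by have := e' 1 1; rewrite !mul1r => /(_ ew)/eqP; rewrite oner_eq0.
Qed.

Lemma side_eq A c d c' d' s s' p : rhombus_side A c d -> rhombus_side A c' d' ->
  p = c + s%:C * (d - c) -> p = c' + s'%:C * (d' - c') ->
  [\/ rhombus_corner A p, c' = c /\ d' = d | c' = d /\ d' = c].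
Proof.
move=> [v h] h' e e'.
have [hc1 hc2 hc3 hc4] := rhombus_corners4 h.
have cd : c + (d - c) = d by rewrite addrC subrK.
rewrite !cd in hc2 hc4.
have c0 := rhombus_cr h.
have key k l : p = c + k%:C * (d - c) + l%:C * v -> s = k /\ 0 = l.
  rewrite e -addrA => /addrI e1.
  by apply: (cross_coord c0); rewrite -e1 mul0r addr0.
case: (rhombus_sideP h h') => -[[ec' ed']|[ec' ed']|[ec' ed']|[ec' ed']];
  rewrite ?cd in ec' ed'.
- by apply: Or32.
- by apply: Or33.
- have [_ /esym/eqP] : s = s' /\ 0 = 1 :> R; last by rewrite oner_eq0.
  by apply: key; rewrite e' ec' ed'; apply: complex_eq; rewrite !ReImE; ring.
- have [_ /esym/eqP] : s = 1 - s' /\ 0 = 1 :> R; last by rewrite oner_eq0.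
  by apply: key; rewrite e' ec' ed'; apply: complex_eq; rewrite !ReImE; ring.
- have [es _] : s = 0 /\ 0 = s'.
    by apply: key; rewrite e' ec' ed'; apply: complex_eq; rewrite !ReImE; ring.
  by apply: Or31; rewrite e es mul0r addr0.
- have [es _] : s = 0 /\ 0 = 1 - s'.
    by apply: key; rewrite e' ec' ed'; apply: complex_eq; rewrite !ReImE; ring.
  by apply: Or31; rewrite e es mul0r addr0.
- have [es _] : s = 1 /\ 0 = s'.
    by apply: key; rewrite e' ec' ed'; apply: complex_eq; rewrite !ReImE; ring.
  by apply: Or31; rewrite e es mul1r cd.
- have [es _] : s = 1 /\ 0 = 1 - s'.
    by apply: key; rewrite e' ec' ed'; apply: complex_eq; rewrite !ReImE; ring.
  by apply: Or31; rewrite e es mul1r cd.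
Qed.

Variable L : rhombic_lattice R.

Lemma faces_meet A B p : faces L A -> faces L B -> A <> B -> A p -> B p ->
  (rhombus_corner A p /\ rhombus_corner B p /\ forall z, A z -> B z -> z = p) \/
  exists c d s, [/\ rhombus_side A c d, rhombus_side B c d, 0 <= s <= 1,
    p = c + s%:C * (d - c) & forall z, A z -> B z -> closed_segment c d z].
Proof.
move=> fA fB AB Ap Bp.
case: (faces_edge_to_edge fA fB AB) => [e|[a [h1 h2 e]]|[c [d [h1 h2 e]]]].
- by have : (A `&` B) p by []; rewrite e.
- have ep : p = a by have : (A `&` B) p by []; rewrite e.
  left; rewrite ep; split=> //; split=> // z Az Bz.
  by have : (A `&` B) z by []; rewrite e.
- right; have [s hs es] : closed_segment c d p by rewrite -e.
  by exists c, d, s; split=> // z Az Bz; rewrite -e.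
Qed.

(** The intersection of two distinct faces lies on a line, so it cannot contain three noncollinear
    points. Disjointness of interiors is used in this form. *)
Lemma faces_inter_thin A B p w1 w2 : faces L A -> faces L B ->
  A p -> A (p + w1) -> A (p + w2) -> B p -> B (p + w1) -> B (p + w2) ->
  cr w1 w2 != 0 -> A = B.
Proof.
move=> fA fB Ap A1 A2 Bp B1 B2 c0; apply: contrapT => AB.
case: (faces_meet fA fB AB Ap Bp) => [[_ [_ h]]|[c [d [s [_ _ _ ep h]]]]].
  move: c0; have -> : w1 = 0 by apply: (addrI p); rewrite addr0; exact: h.
  by rewrite /cr /= !mul0r subrr eqxx.
have [s1 _ e1] := h _ A1 B1; have [s2 _ e2] := h _ A2 B2.
have h1 : w1 = (s1 - s)%:C * (d - c).
  apply: (addrI p); rewrite e1 ep; apply: complex_eq; rewrite !ReImE; ring.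
have h2 : w2 = (s2 - s)%:C * (d - c).
  apply: (addrI p); rewrite e2 ep; apply: complex_eq; rewrite !ReImE; ring.
by move: c0; rewrite h1 h2 !crZl !crZr crxx !mulr0 eqxx.
Qed.

Lemma vertex_corner B w : vertices L w -> faces L B -> B w -> rhombus_corner B w.
Proof.
move=> [A fA Aw] fB Bw.
have [<-//|AB] := pselect (A = B).
case: (faces_meet fA fB AB (rhombus_corner_mem Aw) Bw) => [[_ []]//|].
move=> [c [d [s [h1 h2 _ e _]]]].
case: (corner_on_side Aw h1 e) => ->.
  exact: rhombus_side_corner h2.
exact: rhombus_side_corner (rhombus_sideC h2).
Qed.

(** If p is a vertex, take p itself; if p is inside a side, all faces at p have that side; otherwise
    only one face contains p. Thanks to this, a property of corners passes between any two faces
    that meet. *)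
Lemma faces_common_corner p : exists c, forall A, faces L A -> A p -> rhombus_corner A c.
Proof.
have [A fA Ap] := faces_cover L p.
have [vp|nvp] := pselect (vertices L p).
  by exists p => B fB Bp; exact: vertex_corner.
have [[B [fB Bp AB]]|hA] := pselect (exists B, [/\ faces L B, B p & A <> B]); last first.
  have [a [u [v h]]] := faces_rhombus fA.
  exists a => B fB Bp; have [<-|AB] := pselect (A = B); last by case: hA; exists B.
  by apply/rhombus_cornerP; exists u, v.
have side D : faces L D -> D p -> A <> D -> exists c d s,
    [/\ rhombus_side A c d, rhombus_side D c d & p = c + s%:C * (d - c)].
  move=> fD Dp AD; case: (faces_meet fA fD AD Ap Dp) => [[h _]|].
    by case: nvp; exists A.
  by move=> [c [d [s [h1 h2 _ e _]]]]; exists c, d, s.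
have [c [d [s [hA hB e]]]] := side _ fB Bp AB.
exists c => D fD Dp.
have [<-|AD] := pselect (A = D); first exact: rhombus_side_corner hA.
have [c' [d' [s' [hA' hD e']]]] := side _ fD Dp AD.
case: (side_eq hA hA' e e') => [h|[ec ed]|[ec ed]].
- by case: nvp; exists A.
- by rewrite -ec; exact: rhombus_side_corner hD.
- by rewrite -ed; exact: rhombus_side_corner (rhombus_sideC hD).
Qed.

End Faces.

(** * Local finiteness of the tiling *)

Section LocalFiniteness.
Variable R : realType.
Local Notation C := R[i].
Implicit Types (A B : set C) (a b c d p q u v w z : C) (r s t : R).

(** Together with [rhombus_diam_ex] this computes the squared diameter, attained on the longer
    diagonal. *)
Lemma rhombus_diam_le A a u v p q : rhombus A a u v -> A p -> A q ->
  dt (p - q) (p - q) <= 2 + 2 * `|dt u v|.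
Proof.
move=> h /(rhombus_memP h)[s [t [/andP[s0 s1] /andP[t0 t1] ->]]].
move=> /(rhombus_memP h)[s' [t' [/andP[s0' s1'] /andP[t0' t1'] ->]]].
case: (h) => /unit_normP hu /unit_normP hv _ _ _.
set x := s - s'; set y := t - t'.
rewrite (_ : dt _ _ = x ^+ 2 * dt u u + y ^+ 2 * dt v v + 2 * (x * y) * dt u v); last first.
  by rewrite /dt !ReImE /x /y; ring.
rewrite hu hv !mulr1.
have hx : x ^+ 2 <= 1 by rewrite /x; nra.
have hy : y ^+ 2 <= 1 by rewrite /y; nra.
have hxy : `|x * y| <= 1.
  by rewrite ler_norml; apply/andP; split; nra.
have h2 : (x * y) * dt u v <= `|dt u v|.
  apply: le_trans (ler_norm _) _; rewrite normrM.
  by rewrite -[leRHS]mul1r ler_wpM2r.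
lra.
Qed.

Lemma rhombus_diam_ex A a u v : rhombus A a u v ->
  exists p q, [/\ A p, A q & dt (p - q) (p - q) = 2 + 2 * `|dt u v|].
Proof.
move=> h; have [h1 h2 h3 h4] := rhombus_corners4 h.
case: (h) => /unit_normP hu /unit_normP hv _ _ _.
have [d0|d0] := leP 0 (dt u v).
  exists (a + u + v), a; split; [exact: rhombus_corner_mem|exact: rhombus_corner_mem|].
  have -> : 2 + 2 * `|dt u v| = dt u u + dt v v + 2 * dt u v by rewrite hu hv ger0_norm.
  by rewrite /dt !ReImE; ring.
exists (a + u), (a + v); split; [exact: rhombus_corner_mem|exact: rhombus_corner_mem|].
have -> : 2 + 2 * `|dt u v| = dt u u + dt v v - 2 * dt u v.
  by rewrite hu hv ltr0_norm //; ring.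
by rewrite /dt !ReImE; ring.
Qed.

Variable L : rhombic_lattice R.

(** Congruence is only an isometry of point sets, so it is exploited through the diameter: this
    controls [dt u v], hence the area, because the squares of [cr] and [dt] add up to 1 for unit
    vectors. *)
Lemma faces_cr_bound : exists2 m : R, 0 < m &
  forall A a u v, faces L A -> rhombus A a u v -> m <= `|cr u v|.
Proof.
have [A0 fA0 _] := faces_cover L 0.
have [a0 [u0 [v0 h0]]] := faces_rhombus fA0.
exists `|cr u0 v0|; first by rewrite normr_gt0; exact: rhombus_cr h0.
move=> A a u v fA h.
have [g iso gA] := faces_congruent fA fA0.
have [p [q [Ap Aq e]]] := rhombus_diam_ex h.
have e' : dt (g p - g q) (g p - g q) = dt (p - q) (p - q).
  by apply: complexI; rewrite !dt_norm iso.
have gp : A0 (g p) by rewrite -gA; exists p.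
have gq : A0 (g q) by rewrite -gA; exists q.
have hle := rhombus_diam_le h0 gp gq; rewrite e' e in hle.
have {}hle : `|dt u v| <= `|dt u0 v0| by lra.
case: (h) => /unit_normP hu /unit_normP hv _ _ _.
case: (h0) => /unit_normP hu0 /unit_normP hv0 _ _ _.
have := cr_dt u v; have := cr_dt u0 v0.
rewrite hu hv hu0 hv0 !mulr1 -(real_normK (num_real (cr u v))) -(real_normK (num_real (cr u0 v0))).
rewrite -(real_normK (num_real (dt u v))) -(real_normK (num_real (dt u0 v0))).
have := normr_ge0 (dt u v); have := normr_ge0 (cr u v); have := normr_ge0 (cr u0 v0).
nra.
Qed.

(** The complement is open because the two coordinates relative to u, v are Lipschitz functions. *)
Lemma notin_rhombus_near A a u v p : rhombus A a u v -> ~ A p ->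
  exists2 r : R, 0 < r & forall z, box p r z -> ~ A z.
Proof.
move=> h nA; have c0 := rhombus_cr h.
case: (h) => hu hv _ _ _.
pose D := `|cr u v|; have D0 : 0 < D by rewrite normr_gt0.
pose f z := cr (z - a) v / cr u v; pose g z := cr u (z - a) / cr u v.
have fz r z : box p r z -> `|f z - f p| < 2 * r / D.
  move=> /(cr_box_lt hv) hz; rewrite /f -mulrBl normrM normfV ltr_pM2r ?invr_gt0//.
  by rewrite -crNl -crDl; apply: le_lt_trans hz; rewrite opprB addrA subrK.
have gz r z : box p r z -> `|g z - g p| < 2 * r / D.
  move=> /(cr_box_lt hu) hz; rewrite /g -mulrBl normrM normfV ltr_pM2r ?invr_gt0//.
  rewrite -crNr -crDr crC normrN; apply: le_lt_trans hz.
  by rewrite opprB addrA subrK.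
clear hu hv.
have key (F : C -> R) : (forall r z, box p r z -> `|F z - F p| < 2 * r / D) ->
    ~ (0 <= F p <= 1) -> exists2 r : R, 0 < r & forall z, box p r z -> ~ (0 <= F z <= 1).
  move=> hF /negP; rewrite negb_and -!ltNge => /orP[n|n].
    exists (- F p * D / 2); first by nra.
    move=> z /hF; rewrite [2 * _]mulrC divfK ?pnatr_eq0// mulfK ?gt_eqF//.
    by rewrite ltr_norml => /andP[_ h1] /andP[h2 _]; lra.
  exists ((F p - 1) * D / 2); first by nra.
  move=> z /hF; rewrite [2 * _]mulrC divfK ?pnatr_eq0// mulfK ?gt_eqF//.
  by rewrite ltr_norml => /andP[h1 _] /andP[_ h2]; lra.
have [hf|hf] := pselect (0 <= f p <= 1).
  have [|r r0 hr] := key g gz; first by move=> hg; apply: nA; apply/(rhombus_coordP p h).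
  by exists r => // z /hr hz /(rhombus_coordP z h)[].
have [r r0 hr] := key f fz hf.
by exists r => // z /hr hz /(rhombus_coordP z h)[].
Qed.

(** Relative to a class [P] of faces, so that the radii of finitely many classes can be combined by
    a minimum. *)
Definition good_radius p (P : set C -> Prop) r := 0 < r /\
  forall A z, faces L A -> P A -> A z -> box p r z -> A p.

Lemma good_radius_le p P r r' : good_radius p P r -> 0 < r' -> r' <= r -> good_radius p P r'.
Proof.
move=> [r0 h] r0' le; split=> // A z fA PA Az [h1 h2].
by apply: (h A z) => //; split; apply: lt_le_trans le.
Qed.

Lemma good_radius_bigcup p (P : nat -> set C -> Prop) :
  (forall i, exists r, good_radius p (P i) r) ->
  forall n, exists r, good_radius p (fun A => exists2 i, (i < n)%N & P i A) r.
Proof.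
move=> h; elim=> [|n [r1 h1]]; first by exists 1; split=> // A z _ [].
have [r2 h2] := h n.
exists (Num.min r1 r2).
have r0 : 0 < Num.min r1 r2 by rewrite lt_min (proj1 h1) (proj1 h2).
split=> // A z fA [k]; rewrite ltnS leq_eqVlt => /orP[/eqP->|lt] Pi Az hz.
  have le2 : Num.min r1 r2 <= r2 by rewrite ge_min lexx orbT.
  by have [_ H] := good_radius_le h2 r0 le2; apply: (H A z).
have le1 : Num.min r1 r2 <= r1 by rewrite ge_min lexx.
by have [_ H] := good_radius_le h1 r0 le1; apply: (H A z) => //; exists k.
Qed.

(** Centres a + u/2 + v/2 are sorted into square cells of side r. The shift by 4 keeps the indices
    natural: the centre of a face meeting [box p 1] is off p by less than 2 in each coordinate. *)
Definition center_in p r (i j : nat) A := exists a u v, [/\ rhombus A a u v,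
  i%:R * r <= complex.Re (a + 2^-1%:C * u + 2^-1%:C * v - p) + 4 < i.+1%:R * r &
  j%:R * r <= complex.Im (a + 2^-1%:C * u + 2^-1%:C * v - p) + 4 < j.+1%:R * r].

Lemma center_in_unique p : exists2 r : R, 0 < r & forall A B i j, faces L A -> faces L B ->
  center_in p r i j A -> center_in p r i j B -> A = B.
Proof.
have [m m0 hm] := faces_cr_bound.
(* As |[cr]| is at least m, a face contains the box of half-side m/4 about its centre. Centres in
   one cell differ by less than m/8 in each coordinate, so their faces share a whole box. *)
exists (m / 8); first by rewrite divr_gt0.
move=> A B i j fA fB [a [u [v [hA xA yA]]]] [b [u' [v' [hB xB yB]]]].
set r := m / 8 in xA yA xB yB; have r0 : 0 < r by rewrite divr_gt0.
set cA := a + _ + _ in xA yA; set cB := b + _ + _ in xB yB.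
have ball D d x y z : faces L D -> rhombus D d x y ->
    box (d + 2^-1%:C * x + 2^-1%:C * y) (2 * r) z -> D z.
  move=> fD h; have := hm _ _ _ _ fD h; have c0 := rhombus_cr h.
  case: (h) => hx hy _ _ _ hD hz; apply/(rhombus_coordP z h).
  set c := d + _ + _ in hz; rewrite -[z](subrK c).
  have e1 : z - c + c - d = z - c + 2^-1%:C * x + 2^-1%:C * y.
    by rewrite /c; apply: complex_eq; rewrite !ReImE; ring.
  have c1 w : cr (w + 2^-1%:C * x + 2^-1%:C * y) y / cr x y = cr w y / cr x y + 2^-1.
    by rewrite 2!crDl !crZl crxx mulr0 addr0 mulrDl mulfK.
  have c2 w : cr x (w + 2^-1%:C * x + 2^-1%:C * y) / cr x y = cr x w / cr x y + 2^-1.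
    by rewrite 2!crDr !crZr crxx mulr0 addr0 mulrDl mulfK.
  rewrite e1 c1 c2.
  have D0 : 0 < `|cr x y| by rewrite normr_gt0.
  have small (k : R) : `|k| < 2 * (2 * r) -> 0 <= k / cr x y + 2^-1 <= 1.
    move=> hk; have : `|k / cr x y| <= 2^-1.
      rewrite normrM normfV ler_pdivrMr//; rewrite /r in hk; lra.
    by rewrite ler_norml => /andP[? ?]; apply/andP; split; lra.
  split; apply: small; first exact: cr_box_lt.
  by rewrite crC normrN; exact: cr_box_lt.
have dxy (x y k l : R) (n : nat) : n%:R * r <= x + 4 < n.+1%:R * r ->
    n%:R * r <= y + 4 < n.+1%:R * r -> `|k| <= r -> k = l -> `|y + l - x| < 2 * r.
  rewrite -natr1 mulrDl mul1r => /andP[h1 h2] /andP[h3 h4].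
  by rewrite !ler_norml ltr_norml => /andP[h5 h6] <-; apply/andP; split; lra.
have near w : `|complex.Re w| <= r -> `|complex.Im w| <= r ->
    A (cB + w) /\ B (cB + w).
  move=> h1 h2; split.
    apply: (ball _ _ _ _ _ fA hA); split.
      have := dxy _ _ _ _ _ xA xB h1 erefl.
      by rewrite !ReImE; congr (`|_| < _); ring.
    have := dxy _ _ _ _ _ yA yB h2 erefl.
    by rewrite !ReImE; congr (`|_| < _); ring.
  apply: (ball _ _ _ _ _ fB hB); rewrite -/cB; split; rewrite addrC addKr.
    by apply: le_lt_trans h1 _; lra.
  by apply: le_lt_trans h2 _; lra.
have rr : `|r| <= r by rewrite ger0_norm // ltW.
have r0' : `|0 : R| <= r by rewrite normr0 ltW.
have [A0 B0] := near 0 r0' r0'; rewrite addr0 in A0 B0.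
have [A1 B1] := near (r +i* 0) rr r0'.
have [A2 B2] := near (0 +i* r) r0' rr.
apply: (faces_inter_thin fA fB A0 A1 A2 B0 B1 B2).
by rewrite /cr /= mul0r subr0 mulf_neq0// gt_eqF.
Qed.

(** Each cell holds the centre of at most one face, which either contains p or keeps a positive
    distance from it; finitely many cells matter. *)
Lemma locally_finite p : exists2 r : R, 0 < r &
  forall A z, faces L A -> A z -> box p r z -> A p.
Proof.
have [m m0 hm] := center_in_unique p.
have cell i j : exists r, good_radius p (center_in p m i j) r.
  have [[A [fA Ac nA]]|none] := pselect (exists A, [/\ faces L A, center_in p m i j A & ~ A p]).
    have [a [u [v h]]] := faces_rhombus fA.
    have [r r0 hr] := notin_rhombus_near h nA.
    exists r; split=> // B z fB Bc Bz bz; have eAB : A = B by exact: hm Ac Bc.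
    by subst B; case: (hr z bz).
  exists 1; split=> // A z fA Ac Az _; apply: contrapT => nA.
  by apply: none; exists A.
pose N := (Num.truncn (8 / m)).+1.
have [r [r0 hr]] := good_radius_bigcup (fun i => good_radius_bigcup (cell i) N) N.
exists (Num.min r 1); first by rewrite lt_min r0 ltr01.
move=> A z fA Az [hz1 hz2].
have [a [u [v h]]] := faces_rhombus fA.
case: (h) => /unit_coord_le1[hu1 hu2] /unit_coord_le1[hv1 hv2] _ _ _.
have [s [t [hs ht ez]]] := rhombus_memP h Az.
have inside (x y k : R) : `|x| <= 1 -> `|y| <= 1 -> `|k + s * x + t * y| < 1 ->
    0 <= k + 2^-1 * x + 2^-1 * y + 4 < 8.
  rewrite !ler_norml ltr_norml => /andP[? ?] /andP[? ?] /andP[? ?].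
  by case/andP: hs => ? ?; case/andP: ht => ? ?; apply/andP; split; nra.
have index (x : R) : 0 <= x < 8 -> exists2 i, (i < N)%N & i%:R * m <= x < i.+1%:R * m.
  move=> /andP[x0 x8]; have xm : 0 <= x / m by rewrite divr_ge0 // ltW.
  exists (Num.truncn (x / m)).
    rewrite /N ltnS; apply: le_truncn.
    by rewrite ler_pM2r ?invr_gt0// ltW.
  have /andP[h1 h2] := truncn_itv xm.
  by rewrite -ler_pdivlMr// h1 -ltr_pdivrMr.
move: hz1 hz2; rewrite !lt_min => /andP[hz1 hz1'] /andP[hz2 hz2'].
have b1 : `|complex.Re (a - p) + s * complex.Re u + t * complex.Re v| < 1.
  by move: hz1'; rewrite ez !ReImE; congr (`|_| < _); ring.
have b2 : `|complex.Im (a - p) + s * complex.Im u + t * complex.Im v| < 1.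
  by move: hz2'; rewrite ez !ReImE; congr (`|_| < _); ring.
have [i iN hi] := index _ (inside _ _ _ hu1 hv1 b1).
have [j jN hj] := index _ (inside _ _ _ hu2 hv2 b2).
apply: (hr A z) => //; exists i => //; exists j => //; exists a, u, v; split=> //.
  rewrite (_ : complex.Re _ = complex.Re (a - p) + 2^-1 * complex.Re u + 2^-1 * complex.Re v)//.
  by rewrite !ReImE; ring.
rewrite (_ : complex.Im _ = complex.Im (a - p) + 2^-1 * complex.Im u + 2^-1 * complex.Im v)//.
by rewrite !ReImE; ring.
Qed.

End LocalFiniteness.

(** * Cousin's lemma, propagation along lines and connectedness *)

Section Cousin.
Variable R : realType.

(** The supremum of the right ends reachable from a is itself reachable, and it cannot be smaller
    than b, since the local hypothesis at it reaches further. *)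
Lemma cousin (Pr : R -> R -> Prop) :
  (forall a b c, a <= b -> b <= c -> Pr a b -> Pr b c -> Pr a c) ->
  (forall x, exists2 d, 0 < d & forall a b, a <= x -> x <= b -> b - a < d -> Pr a b) ->
  forall a b, a <= b -> Pr a b.
Proof.
move=> add loc a b ab.
pose S := [set x | a <= x <= b /\ Pr a x].
have Sa : S a.
  split; first by rewrite lexx.
  by have [d d0] := loc a; apply; rewrite ?subrr.
have supS : has_sup S.
  by split; [exists a|exists b => x [/andP[]]].
set s := sup S.
have as_ : a <= s by apply: ub_le_sup => //; exact: supS.2.
have sb : s <= b by apply: ge_sup; [exists a|move=> x [/andP[]]].
have [d d0 hd] := loc s.
have d20 : 0 < d / 2 by rewrite divr_gt0.
have [x [/andP[ax xb] Pax] sx] := sup_adherent d20 supS; rewrite -/s in sx.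
have xs : x <= s by apply: ub_le_sup; [exact: supS.2|split => //; rewrite ax].
(* As s - d/2 < x, the interval from x to y is shorter than d/2 + d/3 < d. *)
pose y := Num.min b (s + d / 3).
have ys : s <= y by rewrite le_min sb /=; lra.
have yd : y <= s + d / 3 by rewrite ge_min lexx orbT.
have yb : y <= b by rewrite ge_min lexx.
have Pay : Pr a y.
  apply: (add _ x) => //; first exact: le_trans ys.
  by apply: hd => //; lra.
have : y <= s.
  by apply: ub_le_sup; [exact: supS.2|split => //; rewrite (le_trans as_ ys)].
move=> ys'; suff <- : y = b by [].
by move: yd ys'; rewrite /y; case: (leP b (s + d / 3)) => // _ _; lra.
Qed.

End Cousin.

Section LineInduction.
Variables (R : realType) (L : rhombic_lattice R).
Local Notation C := R[i].
Implicit Types (A B : set C) (a b c d p q u v w z : C) (r s t x y : R).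

(** By local finiteness, any point of the line close to the one at x shares a face with it; two
    points on either side of x are then linked in two steps through x. *)
Lemma line_induction p d s (P : R -> Prop) :
  (forall x y, 0 <= x -> x <= y -> y <= s ->
     (exists A, [/\ faces L A, A (p + x%:C * d) & A (p + y%:C * d)]) ->
     P x -> P y) ->
  0 <= s -> P 0 -> P s.
Proof.
move=> step s0.
suff : forall x y, x <= y -> 0 <= x -> y <= s -> P x -> P y by apply; rewrite ?lexx.
apply: cousin => [x y z xy yz h1 h2 x0 zs Px|x].
  by apply: h2 => //; [exact: le_trans xy|apply: h1 => //; exact: le_trans zs].
have [r r0 hr] := locally_finite L (p + x%:C * d).
(* A parameter change below r / k moves each coordinate by less than r; the summand 1 keeps k
   positive. *)
pose k := 1 + `|complex.Re d| + `|complex.Im d|.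
have k0 : 0 < k by rewrite /k -addrA ltr_wpDr// addr_ge0.
exists (r / k); first by rewrite divr_gt0.
move=> y z yx xz hyz y0 zs Py.
have inbox t : y <= t -> t <= z -> box (p + x%:C * d) r (p + t%:C * d).
  move=> yt tz.
  rewrite /box; have -> : p + t%:C * d - (p + x%:C * d) = (t - x)%:C * d.
    by apply: complex_eq; rewrite !ReImE; ring.
  have ht : `|t - x| * k < r.
    rewrite -ltr_pdivlMr//; apply: le_lt_trans hyz.
    by rewrite ler_norml; apply/andP; split; lra.
  have := normr_ge0 (t - x); have := normr_ge0 (complex.Re d).
  have := normr_ge0 (complex.Im d); rewrite /k in ht.
  by split; rewrite ?ReZ ?ImZ normrM; nra.
have share t : y <= t -> t <= z ->
    exists A, [/\ faces L A, A (p + t%:C * d) & A (p + x%:C * d)].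
  move=> yt tz; have [A fA At] := faces_cover L (p + t%:C * d).
  by exists A; split=> //; apply: hr At (inbox _ yt tz).
have yz : y <= z by exact: le_trans xz.
apply: (step x z) => //; [exact: le_trans yx| |].
  by have [A [? ? ?]] := share z yz (lexx z); exists A.
apply: (step y x) => //; first exact: le_trans zs.
exact: share.
Qed.

Lemma rhombus_sides4 A a u v : rhombus A a u v ->
  [/\ rhombus_side A a (a + u), rhombus_side A a (a + v),
      rhombus_side A (a + u) (a + u + v) & rhombus_side A (a + v) (a + u + v)].
Proof.
move=> h; have h' := rhombus_swap h.
have h1 := rhombus_swap (rhombus_flip h).
have h2 := rhombus_swap (rhombus_flip h').
by split; [exists v|exists u|exists (- u)|exists (- v)];
  rewrite ?[a + _ - a]addrC ?addKr // [_ - _]addrC ?[a + u + v]addrAC ?addKr // addrAC addKr.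
Qed.

Lemma edge_sym a b : edge L a b -> edge L b a.
Proof. by case=> A fA h; exists A => //; exact: rhombus_sideC. Qed.

Lemma edge_vertex a b : edge L a b -> vertices L a.
Proof. by case=> A fA h; exists A => //; exact: rhombus_side_corner h. Qed.

Lemma rhombus_corners_connected (Q : C -> Prop) A c c' :
  (forall a b, rhombus_side A a b -> Q a -> Q b) ->
  rhombus_corner A c -> rhombus_corner A c' -> Q c -> Q c'.
Proof.
move=> hQ /rhombus_cornerP[u [v h]] /rhombus_cornerP[u' [v' h']] Qc.
have [s1 s2 s3 s4] := rhombus_sides4 h.
have [->|->|->|->] := rhombus_corner4 h h'; [by []|exact: hQ Qc|exact: hQ Qc|].
by apply: (hQ _ _ s3); exact: hQ Qc.
Qed.

(** Follow the segment from a to b: faces meeting at a point of it share a corner, and the corners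
    of one face are joined by its sides. *)
Lemma vertices_connected (Q : C -> Prop) a b :
  (forall a b, edge L a b -> Q a -> Q b) ->
  vertices L a -> vertices L b -> Q a -> Q b.
Proof.
move=> hQ va vb Qa.
have face A c c' : faces L A -> rhombus_corner A c -> rhombus_corner A c' -> Q c -> Q c'.
  by move=> fA; apply: rhombus_corners_connected => x y hxy; apply: hQ; exists A.
pose P s := forall A c, faces L A -> A (a + s%:C * (b - a)) -> rhombus_corner A c -> Q c.
have P0 : P 0.
  move=> A c fA; rewrite mul0r addr0 => Aa Ac.
  exact: face (vertex_corner va fA Aa) Ac Qa.
have : P 1.
  apply: (@line_induction a (b - a) 1 P) => // x y _ _ _ [A [fA Ax Ay]] Px B c fB By Bc.
  have [k hk] := faces_common_corner L (a + y%:C * (b - a)).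
  exact: face fB (hk _ fB By) Bc (Px A k fA Ax (hk _ fA Ay)).
move=> P1; have [A fA Ab] := vb; apply: (P1 A b fA _ Ab).
by rewrite mul1r addrC subrK; exact: rhombus_corner_mem.
Qed.

End LineInduction.

(** * Flat transports along edges: sections over a single face *)

Section Monodromy.
Variables (R : realType) (L : rhombic_lattice R).
Local Notation C := R[i].
Implicit Types (A B : set C) (a b c d p q u v w z : C) (r s t : R).
Variables (T : Type) (tau : C -> C -> T -> T).
Hypothesis tauK : forall a b x, edge L a b -> tau b a (tau a b x) = x.
Hypothesis tau_flat : forall A, faces L A -> exists a u v, rhombus A a u v /\
  forall x, tau (a + u) (a + u + v) (tau a (a + u) x) =
            tau (a + v) (a + u + v) (tau a (a + v) x).

(** [ev c x] is the value at the corner c of the section over A whose value at the base corner is x.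
    Flatness makes the two routes to the far corner agree, and T parametrizes the sections through
    the value at any corner. *)
Lemma face_section_ex A : faces L A -> exists ev : C -> T -> T,
  [/\ forall c d x, rhombus_side A c d -> ev d x = tau c d (ev c x),
      forall c y, rhombus_corner A c -> exists x, ev c x = y &
      forall c, rhombus_corner A c -> injective (ev c)].
Proof.
move=> fA; have [a [u [v [h flat]]]] := tau_flat fA.
have [s1 s2 s3 s4] := rhombus_sides4 h.
have edg c d : rhombus_side A c d -> edge L c d by move=> ?; exists A.
have u0 := rhombus_neq0 h; have v0 := rhombus_neq0 (rhombus_swap h).
case: (h) => _ _ vu vNu _.
pose ev c x := if c == a then x else if c == a + u then tau a (a + u) x
  else if c == a + v then tau a (a + v) x
  else tau (a + u) (a + u + v) (tau a (a + u) x).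
have e1 x : ev a x = x by rewrite /ev eqxx.
have e2 x : ev (a + u) x = tau a (a + u) x.
  by rewrite /ev eqxx -subr_eq0 addrC addKr (negPf u0).
have e3 x : ev (a + v) x = tau a (a + v) x.
  rewrite /ev eqxx -subr_eq0 addrC addKr (negPf v0); by case: (a + v =P a + u) => // /addrI.
have e4 x : ev (a + u + v) x = tau (a + u) (a + u + v) (tau a (a + u) x).
  rewrite /ev; case: (a + u + v =P a) => [e|_].
    case: vNu; apply/eqP; rewrite -subr_eq0 opprK; apply/eqP; apply: (addrI a).
    by rewrite addr0 [v + u]addrC addrA.
  case: (a + u + v =P a + u) => [/eqP|_].
    by rewrite -[X in _ == X]addr0 (inj_eq (addrI _)) (negPf v0).
  case: (a + u + v =P a + v) => [/eqP|_] //.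
  by rewrite addrAC -[X in _ == X]addr0 (inj_eq (addrI _)) (negPf u0).
have tK c d x : rhombus_side A c d -> tau d c (tau c d x) = x by move=> /edg; exact: tauK.
exists ev; split=> [c d x hcd|c y /rhombus_cornerP[u' [v' h']]|c /rhombus_cornerP[u' [v' h']]].
- case: (rhombus_sideP h hcd) => -[[-> ->]|[-> ->]|[-> ->]|[-> ->]];
  rewrite ?e1 ?e2 ?e3 ?e4 ?(tK _ _ _ s1) ?(tK _ _ _ s2) ?(tK _ _ _ s3) //;
  by rewrite flat (tK _ _ _ s4).
- have [->|->|->|->] := rhombus_corner4 h h'.
  + by exists y.
  + by exists (tau (a + u) a y); rewrite e2 tK //; exact: rhombus_sideC.
  + by exists (tau (a + v) a y); rewrite e3 tK //; exact: rhombus_sideC.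
  + exists (tau (a + u) a (tau (a + u + v) (a + u) y)).
    by rewrite e4 !tK //; exact: rhombus_sideC.
- move=> x y; have [->|->|->|->] := rhombus_corner4 h h'; rewrite ?e1 ?e2 ?e3 ?e4 //.
  + by move/(congr1 (tau (a + u) a)); rewrite !tK.
  + by move/(congr1 (tau (a + v) a)); rewrite !tK.
  + by move/(congr1 (tau (a + u + v) (a + u)))/(congr1 (tau (a + u) a)); rewrite !tK.
Qed.

Lemma face_sections_ex : exists ev : set C -> C -> T -> T, forall A, faces L A ->
  [/\ forall c d x, rhombus_side A c d -> ev A d x = tau c d (ev A c x),
      forall c y, rhombus_corner A c -> exists x, ev A c x = y &
      forall c, rhombus_corner A c -> injective (ev A c)].
Proof.
suff : forall A, exists ev : C -> T -> T, faces L A ->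
  [/\ forall c d x, rhombus_side A c d -> ev d x = tau c d (ev c x),
      forall c y, rhombus_corner A c -> exists x, ev c x = y &
      forall c, rhombus_corner A c -> injective (ev c)].
  by move=> /choice[ev h]; exists ev.
move=> A; have [fA|nA] := pselect (faces L A); last by exists (fun _ => id).
by have [ev h] := face_section_ex fA; exists ev.
Qed.

End Monodromy.

(** * From sections over faces to sections over rectangles and the whole lattice *)

Section Developments.
Variables (R : realType) (L : rhombic_lattice R).
Local Notation C := R[i].
Implicit Types (A B : set C) (Q : set C) (a b c d p q u v w z : C) (r s t : R).
Variables (T : Type) (tau : C -> C -> T -> T) (ev : set C -> C -> T -> T).
Hypothesis ev_side : forall A c d x, faces L A -> rhombus_side A c d ->
  ev A d x = tau c d (ev A c x).
Hypothesis ev_surj : forall A c y, faces L A -> rhombus_corner A c ->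
  exists x, ev A c x = y.
Hypothesis ev_inj : forall A c, faces L A -> rhombus_corner A c ->
  injective (ev A c).
Implicit Types (m : set C -> T).

Definition agree_on A B (x y : T) := forall c,
  rhombus_corner A c -> rhombus_corner B c -> ev A c x = ev B c y.

(** A section over the faces meeting Q, stored as one parameter per face. Compatibility is imposed
    only on faces with a common point in Q, so restricting Q weakens the condition. *)
Definition development Q m := forall A B p, faces L A -> faces L B ->
  Q p -> A p -> B p -> agree_on A B (m A) (m B).

Definition developable Q := forall A x, faces L A -> (exists2 p, Q p & A p) ->
  exists2 m, m A = x & development Q m.

Definition segment_closed Q := forall p q s, Q p -> Q q -> 0 <= s <= 1 ->
  Q (p + s%:C * (q - p)).

(** Distinct faces meet either in c alone or in a side ending at c, along which [tau] carries the
    agreement to the other end. *)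
Lemma agree_on_corner A B c x y : faces L A -> faces L B ->
  rhombus_corner A c -> rhombus_corner B c -> ev A c x = ev B c y ->
  agree_on A B x y.
Proof.
move=> fA fB Ac Bc e c' Ac' Bc'.
have [AB|AB] := pselect (A = B).
  by subst B; rewrite (ev_inj fA Ac e).
case: (faces_meet fA fB AB (rhombus_corner_mem Ac) (rhombus_corner_mem Bc))
  => [[_ [_ h]]|[k [l [s [hA hB _ ec h]]]]].
  by rewrite (h c' (rhombus_corner_mem Ac') (rhombus_corner_mem Bc')).
have [s' _ ec'] := h c' (rhombus_corner_mem Ac') (rhombus_corner_mem Bc').
have ckl : c = k \/ c = l by exact: corner_on_side Ac hA ec.
have ekl : ev A k x = ev B k y /\ ev A l x = ev B l y.
  case: ckl => ck; rewrite ck in e.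
    by split=> //; rewrite (ev_side _ fA hA) (ev_side _ fB hB) e.
  split=> //; rewrite (ev_side _ fA (rhombus_sideC hA)).
  by rewrite (ev_side _ fB (rhombus_sideC hB)) e.
by case: (corner_on_side Ac' hA ec') => ->; case: ekl.
Qed.

(** Equality spreads along the segment from p to q, through a corner common to all faces at each
    point. *)
Lemma development_unique Q m m' A B p q : segment_closed Q ->
  development Q m -> development Q m' -> faces L A -> faces L B ->
  Q p -> Q q -> A p -> B q -> m A = m' A -> m B = m' B.
Proof.
move=> cQ dm dm' fA fB Qp Qq Ap Bq e.
have step D E z : faces L D -> faces L E -> Q z -> D z -> E z -> m D = m' D -> m E = m' E.
  move=> fD fE Qz Dz Ez eD.
  have [c hc] := faces_common_corner L z.
  apply: (ev_inj fE (hc _ fE Ez)).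
  rewrite -(dm D E z fD fE Qz Dz Ez c) ?eD; [|exact: hc|exact: hc].
  by rewrite (dm' D E z fD fE Qz Dz Ez c) //; exact: hc.
pose P s := forall D, faces L D -> D (p + s%:C * (q - p)) -> m D = m' D.
suff P1 : P 1 by apply: P1 => //; rewrite mul1r addrC subrK.
apply: (@line_induction _ L p (q - p) 1 P) => //.
  move=> x y x0 xy y1 [D [fD Dx Dy]] Px E fE Ey.
  apply: (step D E _ fD fE _ Dy Ey (Px _ fD Dx)).
  by apply: cQ => //; rewrite y1 (le_trans x0).
by move=> D fD; rewrite mul0r addr0 => Dp; exact: (step A D p).
Qed.

Lemma development_sub Q Q' m : Q' `<=` Q -> development Q m -> development Q' m.
Proof. by move=> sQ dm A B p fA fB /sQ; exact: dm. Qed.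

(** Develop over the region where the data are given, then restart over the other one from a face at
    a common point. A face meeting both regions meets their intersection, over which the two
    developments agree by uniqueness. *)
Lemma developable_glue Q1 Q2 : segment_closed (Q1 `&` Q2) -> (Q1 `&` Q2) !=set0 ->
  (forall A, faces L A -> (exists2 p, Q1 p & A p) -> (exists2 p, Q2 p & A p) ->
    exists2 p, (Q1 `&` Q2) p & A p) ->
  developable Q1 -> developable Q2 -> developable (Q1 `|` Q2).
Proof.
have main Q1' Q2' : forall A x, faces L A -> (exists2 p, Q1' p & A p) ->
    segment_closed (Q1' `&` Q2') -> (Q1' `&` Q2') !=set0 ->
  (forall A, faces L A -> (exists2 p, Q1' p & A p) -> (exists2 p, Q2' p & A p) ->
    exists2 p, (Q1' `&` Q2') p & A p) ->
  developable Q1' -> developable Q2' ->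
  exists2 m, m A = x & development (Q1' `|` Q2') m.
  move: Q1' Q2' => {}Q1 {}Q2 A x fA AQ cQ [o oQ] meet D1 D2.
  have [m1 e1 dm1] := D1 A x fA AQ.
  have [O fO Oo] := faces_cover L o.
  have [m2 e2 dm2] := D2 O (m1 O) fO (ex_intro2 _ _ o oQ.2 Oo).
  have same B : faces L B -> (exists2 p, Q1 p & B p) -> (exists2 p, Q2 p & B p) ->
      m2 B = m1 B.
    move=> fB B1 B2; have [p Qp Bp] := meet _ fB B1 B2.
    apply: (@development_unique (Q1 `&` Q2) m2 m1 O B o p) => //.
      by apply: development_sub dm2 => z [].
    by apply: development_sub dm1 => z [].
  pose m B := if pselect (exists2 p, Q1 p & B p) then m1 B else m2 B.
  have val1 B p : Q1 p -> B p -> m B = m1 B.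
    by move=> Qp Bp; rewrite /m; case: (pselect _) => // -[]; exists p.
  have val2 B p : faces L B -> Q2 p -> B p -> m B = m2 B.
    move=> fB Qp Bp; rewrite /m; case: (pselect _) => // h.
    by rewrite same //; exists p.
  exists m; first by case: AQ => p Qp Ap; rewrite (val1 _ p).
  move=> D E p fD fE [Qp|Qp] Dp Ep.
    by rewrite !(val1 _ p) //; exact: dm1 Qp Dp Ep.
  by rewrite !(val2 _ p) //; exact: dm2 Qp Dp Ep.
move=> cQ nQ meet D1 D2 A x fA [p [Qp|Qp] Ap].
  by apply: main => //; exists p.
rewrite setUC; apply: (main Q2 Q1) => //; rewrite 1?setIC //; first by exists p.
by move=> B fB B1 B2; exact: meet fB B2 B1.
Qed.

Definition rect x0 x1 y0 y1 : set C := [set z |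
  x0 <= complex.Re z <= x1 /\ y0 <= complex.Im z <= y1].

Lemma rhombus_convex A a u v p q s : rhombus A a u v -> A p -> A q ->
  0 <= s <= 1 -> A (p + s%:C * (q - p)).
Proof.
move=> h /(rhombus_memP h)[k [l [hk hl ->]]] /(rhombus_memP h)[k' [l' [hk' hl' ->]]] hs.
rewrite (_ : _ + _ * _ = a + (k + s * (k' - k))%:C * u + (l + s * (l' - l))%:C * v).
  apply: rhombus_mem => //.
    by case/andP: hs hk hk' => ? ? /andP[? ?] /andP[? ?]; apply/andP; split; nra.
  by case/andP: hs hl hl' => ? ? /andP[? ?] /andP[? ?]; apply/andP; split; nra.
by apply: complex_eq; rewrite !ReImE; ring.
Qed.

Lemma rect_convex x0 x1 y0 y1 : segment_closed (rect x0 x1 y0 y1).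
Proof.
move=> p q s [/andP[? ?] /andP[? ?]] [/andP[? ?] /andP[? ?]] /andP[? ?].
by split; rewrite !ReImE; apply/andP; split; nra.
Qed.

Lemma between (x y z : R) : x <= y -> y <= z -> exists2 s, 0 <= s <= 1 & x + s * (z - x) = y.
Proof.
move=> xy yz; have [e|n] := eqVneq x z.
  by exists 0; rewrite ?lexx ?ler01 // mul0r addr0; lra.
have xz : 0 < z - x by rewrite subr_gt0 lt_def eq_sym n (le_trans xy).
exists ((y - x) / (z - x)); last by rewrite divfK ?gt_eqF// addrC subrK.
by rewrite divr_ge0 ?ler_pdivrMr//= ?mul1r; lra.
Qed.

Lemma developable_gluex x0 x1 x2 y0 y1 : x0 <= x1 -> x1 <= x2 -> y0 <= y1 ->
  developable (rect x0 x1 y0 y1) -> developable (rect x1 x2 y0 y1) ->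
  developable (rect x0 x2 y0 y1).
Proof.
move=> x01 x12 y01 D1 D2.
have -> : rect x0 x2 y0 y1 = rect x0 x1 y0 y1 `|` rect x1 x2 y0 y1.
  apply/seteqP; split=> z; last first.
    by case=> -[/andP[? ?] /andP[? ?]]; split; apply/andP; split=> //; lra.
  move=> [/andP[? ?] hy]; have [?|?] := leP (complex.Re z) x1.
    by left; split=> //; apply/andP.
  by right; split=> //; apply/andP; split=> //; exact: ltW.
apply: developable_glue => //.
- move=> p q s [p1 p2] [q1 q2] hs; split; exact: rect_convex.
- by exists (x1 +i* y0); split; split; rewrite /= ?lexx ?x01 ?y01 ?x12.
- move=> A fA [p [/andP[px0 px1] /andP[py0 py1]] Ap] [q [/andP[qx0 qx1] /andP[qy0 qy1]] Aq].
  have [a [u [v h]]] := faces_rhombus fA.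
  (* A face with points on both sides of the cut contains, by convexity, a point of the cut. *)
  have [s hs e] := between px1 qx0.
  exists (p + s%:C * (q - p)); last exact: rhombus_convex h Ap Aq hs.
  have {}e : complex.Re (p + s%:C * (q - p)) = x1 by rewrite !ReImE.
  have hy : y0 <= complex.Im (p + s%:C * (q - p)) <= y1.
    by rewrite !ReImE; case/andP: hs => ? ?; apply/andP; split; nra.
  by split; split; rewrite // e ?lexx ?x01 ?x12.
Qed.

Lemma developable_gluey x0 x1 y0 y1 y2 : x0 <= x1 -> y0 <= y1 -> y1 <= y2 ->
  developable (rect x0 x1 y0 y1) -> developable (rect x0 x1 y1 y2) ->
  developable (rect x0 x1 y0 y2).
Proof.
move=> x01 y01 y12 D1 D2.
have -> : rect x0 x1 y0 y2 = rect x0 x1 y0 y1 `|` rect x0 x1 y1 y2.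
  apply/seteqP; split=> z; last first.
    by case=> -[/andP[? ?] /andP[? ?]]; split; apply/andP; split=> //; lra.
  move=> [hx /andP[? ?]]; have [?|?] := leP (complex.Im z) y1.
    by left; split=> //; apply/andP.
  by right; split=> //; apply/andP; split=> //; exact: ltW.
apply: developable_glue => //.
- move=> p q s [p1 p2] [q1 q2] hs; split; exact: rect_convex.
- by exists (x0 +i* y1); split; split; rewrite /= ?lexx ?x01 ?y01 ?y12.
- move=> A fA [p [/andP[px0 px1] /andP[py0 py1]] Ap] [q [/andP[qx0 qx1] /andP[qy0 qy1]] Aq].
  have [a [u [v h]]] := faces_rhombus fA.
  have [s hs e] := between py1 qy0.
  exists (p + s%:C * (q - p)); last exact: rhombus_convex h Ap Aq hs.
  have {}e : complex.Im (p + s%:C * (q - p)) = y1 by rewrite !ReImE.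
  have hy : x0 <= complex.Re (p + s%:C * (q - p)) <= x1.
    by rewrite !ReImE; case/andP: hs => ? ?; apply/andP; split; nra.
  by split; split; rewrite // e ?lexx ?y01 ?y12.
Qed.

(** All faces near p contain p and share one corner; prescribing the value there determines the
    section on each of them. *)
Lemma developable_near p : exists2 r : R, 0 < r & forall Q, Q `<=` box p r -> developable Q.
Proof.
have [r r0 hr] := locally_finite L p; exists r => // Q sQ A x fA [q Qq Aq].
have [c hc] := faces_common_corner L p.
have corner B z : faces L B -> Q z -> B z -> rhombus_corner B c.
  by move=> fB /sQ bz Bz; apply: hc => //; exact: hr bz.
have : forall B, exists y, faces L B -> rhombus_corner B c -> ev B c y = ev A c x.
  move=> B; have [[fB Bc]|n] := pselect (faces L B /\ rhombus_corner B c).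
    by have [y e] := ev_surj (ev A c x) fB Bc; exists y.
  by exists x => fB Bc; case: n.
move=> /choice[m hm]; exists m.
  have Ac := corner A q fA Qq Aq.
  exact: ev_inj fA Ac _ _ (hm A fA Ac).
move=> D E z fD fE Qz Dz Ez.
have Dc := corner D z fD Qz Dz; have Ec := corner E z fE Qz Ez.
by apply: (agree_on_corner fD fE Dc Ec); rewrite (hm D) ?(hm E).
Qed.

Lemma developable_rect x0 x1 y0 y1 : x0 <= x1 -> y0 <= y1 ->
  developable (rect x0 x1 y0 y1).
Proof.
move=> x01 y01; move: x0 x1 x01.
(* Cousin's lemma is applied twice: vertically, to get one width valid on the full height at x, and
   then horizontally. *)
have strip (x : R) : exists2 d : R, 0 < d & forall a b : R, a <= x -> x <= b -> b - a < d ->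
    developable (rect a b y0 y1).
  move: y0 y1 y01; apply: cousin => [y0 y1 y2 y01 y12 [d d0 hd] [e e0 he]|y].
    exists (Num.min d e); first by rewrite lt_min d0.
    move=> a b ax xb; rewrite lt_min => /andP[h1 h2].
    by apply: (developable_gluey (y1 := y1)) => //; [lra|exact: hd|exact: he].
  have [r r0 hr] := developable_near (x +i* y).
  exists r => // y0 y1 y0y yy1 hy; exists r => // a b ax xb hx.
  apply: hr => -[z1 z2] [/= /andP[? ?] /andP[? ?]].
  by split => /=; rewrite ltr_norml; apply/andP; split; lra.
apply: cousin => [x0 x1 x2 x01 x12 D1 D2|]; last exact: strip.
exact: developable_gluex D1 D2.
Qed.

Lemma global_section z0 (t0 : T) : vertices L z0 ->
  exists2 f : C -> T, f z0 = t0 &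
    forall a b, edge L a b -> f b = tau a b (f a).
Proof.
move=> vz0; have [A0 fA0 A0z] := vz0.
have [x0 ex0] := ev_surj t0 fA0 A0z.
(* The plane is exhausted by squares, and developments with the same value at z0 agree on
   overlaps. *)
pose sq (n : nat) := rect (- n%:R) n%:R (- n%:R) n%:R.
have sqP z : exists N, forall n, (N <= n)%N -> sq n z.
  exists (maxn (Num.truncn `|complex.Re z|).+1 (Num.truncn `|complex.Im z|).+1).
  move=> n; rewrite geq_max => /andP[h1 h2].
  have lt (x : R) : ((Num.truncn x).+1 <= n)%N -> x <= n%:R.
    by move=> xn; apply: ltW; apply: lt_le_trans (truncnS_gt x) _; rewrite ler_nat.
  move/lt: h1 => h1; move/lt: h2 => h2.
  by move: h1 h2; rewrite !ler_norml.
have : forall n, exists m, sq n z0 -> m A0 = x0 /\ development (sq n) m.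
  move=> n; have [h|h] := pselect (sq n z0); last by exists (fun _ => x0).
  have n0 : - n%:R <= n%:R :> R by have := ler0n R n; lra.
  have [m e dm] := developable_rect n0 n0 x0 fA0 (ex_intro2 _ _ z0 h (rhombus_corner_mem A0z)).
  by exists m.
move=> /choice[m hm].
have uniq n k A p : faces L A -> sq n z0 -> sq k z0 -> sq n p -> sq k p -> A p -> m n A = m k A.
  move=> fA nz kz np kp Ap.
  have [e1 d1] := hm n nz; have [e2 d2] := hm k kz.
  apply: (@development_unique (sq n `&` sq k) _ _ A0 A z0 p) => //.
  - move=> x y s [p1 p2] [q1 q2] hs; split; exact: rect_convex.
  - by apply: development_sub d1 => z [].
  - by apply: development_sub d2 => z [].
  - exact: rhombus_corner_mem.
  - by rewrite e1 e2.
have : forall z, exists y, forall n A, faces L A -> rhombus_corner A z -> sq n z ->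
    sq n z0 -> ev A z (m n A) = y.
  move=> z; have [[B fB Bz]|nz] := pselect (vertices L z); last first.
    by exists t0 => n A fA Az; case: nz; exists A.
  have [N1 h1] := sqP z; have [N2 h2] := sqP z0; pose N := maxn N1 N2.
  have {}h1 := h1 N (leq_maxl _ _); have {}h2 := h2 N (leq_maxr _ _).
  exists (ev B z (m N B)) => n A fA Az nz nz0.
  have [_ d] := hm n nz0.
  rewrite (d A B z) //; [|exact: rhombus_corner_mem|exact: rhombus_corner_mem].
  congr (ev B z _); apply: (uniq _ _ _ z) => //; exact: rhombus_corner_mem.
move=> /choice[f hf]; exists f.
  have [N h] := sqP z0; have {}h := h N (leqnn _).
  by rewrite -(hf z0 N A0) // (hm N h).1 ex0.
move=> a b [A fA hab].
have [N1 h1] := sqP a; have [N2 h2] := sqP b; have [N3 h3] := sqP z0.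
pose N := maxn N1 (maxn N2 N3).
have {}h1 : sq N a by apply: h1; rewrite leq_max leqnn.
have {}h2 : sq N b by apply: h2; rewrite !leq_max leqnn orbT.
have {}h3 : sq N z0 by apply: h3; rewrite !leq_max leqnn !orbT.
rewrite -(hf b N A) //; last exact: rhombus_side_corner (rhombus_sideC hab).
by rewrite -(hf a N A) ?(ev_side _ fA hab) //; exact: rhombus_side_corner hab.
Qed.

End Developments.

Lemma monodromy (R : realType) (L : rhombic_lattice R) (T : Type)
    (tau : R[i] -> R[i] -> T -> T) z0 t0 :
  (forall a b x, edge L a b -> tau b a (tau a b x) = x) ->
  (forall A, faces L A -> exists a u v, rhombus A a u v /\
    forall x, tau (a + u) (a + u + v) (tau a (a + u) x) =
              tau (a + v) (a + u + v) (tau a (a + v) x)) ->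
  vertices L z0 ->
  exists2 f : R[i] -> T, f z0 = t0 & forall a b, edge L a b -> f b = tau a b (f a).
Proof.
move=> hK hflat; have [ev hev] := face_sections_ex hK hflat.
apply: (@global_section _ L T tau ev).
- by move=> A c d x /hev[h _ _]; exact: h.
- by move=> A c y /hev[_ h _]; exact: h.
- by move=> A c /hev[_ _ h]; exact: h.
Qed.

(* Reflection of linear identities in a module to scalar identities, one for
   each vector, which ring and field can prove. *)
Section LinearCombinations.
Variables (K : comNzRingType) (V : lmodType K).

Inductive lincomb :=
  | LVar of nat | LZero | LAdd of lincomb & lincomb | LOpp of lincomb
  | LScale of K & lincomb.

Fixpoint lceval (env : seq V) e : V := match e with
  | LVar k => nth 0 env k
  | LZero => 0
  | LAdd e1 e2 => lceval env e1 + lceval env e2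
  | LOpp e1 => - lceval env e1
  | LScale k e1 => k *: lceval env e1
  end.

(** [eqn] rather than [==], so that [cbv] computes the coefficients in [module_eq]. *)
Fixpoint lccoef (j : nat) e : K := match e with
  | LVar k => if eqn k j then 1 else 0
  | LZero => 0
  | LAdd e1 e2 => lccoef j e1 + lccoef j e2
  | LOpp e1 => - lccoef j e1
  | LScale k e1 => k * lccoef j e1
  end.

Fixpoint lccoef_eq (n : nat) e1 e2 : Prop := match n with
  | 0%N => True
  | n'.+1 => lccoef n' e1 = lccoef n' e2 /\ lccoef_eq n' e1 e2
  end.

Lemma lcevalE env e : lceval env e = \sum_(j < size env) lccoef j e *: nth 0 env j.
Proof.
elim: e => [k||e1 IH1 e2 IH2|e1 IH|k e1 IH] /=.
- case: (ltnP k (size env)) => kn; last first.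
    rewrite nth_default // big1 // => j _; case: eqnP => [e|_]; last by rewrite scale0r.
    by move: (ltn_ord j); rewrite -e ltnNge kn.
  rewrite (bigD1 (Ordinal kn)) //= (introT eqnP erefl) scale1r big1 ?addr0 // => j jk.
  case: eqnP => [e|_]; last by rewrite scale0r.
  by case/eqP: jk; apply: val_inj.
- by rewrite big1 // => j _; rewrite scale0r.
- by rewrite IH1 IH2 -big_split; apply: eq_bigr => j _; rewrite scalerDl.
- by rewrite IH -sumrN; apply: eq_bigr => j _; rewrite scaleNr.
- by rewrite IH scaler_sumr; apply: eq_bigr => j _; rewrite scalerA.
Qed.

Lemma lincomb_eq env e1 e2 : lccoef_eq (size env) e1 e2 -> lceval env e1 = lceval env e2.
Proof.
rewrite !lcevalE; elim: (size env) => [|n IH] /=; first by rewrite !big_ord0.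
by move=> [e /IH h]; rewrite !big_ord_recr /= h e.
Qed.

End LinearCombinations.

Ltac lc_index l x := match l with
  | x :: _ => constr:(0%N)
  | _ :: ?l' => let n := lc_index l' x in constr:(S n)
  end.

Ltac lc_atoms l e := match e with
  | (?x + ?y)%R => let l1 := lc_atoms l x in lc_atoms l1 y
  | (- ?x)%R => lc_atoms l x
  | (_ *: ?x)%R => lc_atoms l x
  | 0%R => l
  | _ => match l with
         | context [e] => l
         | _ => constr:(e :: l)
         end
  end.

Ltac lc_reify K l e := match e with
  | (?x + ?y)%R => let e1 := lc_reify K l x in let e2 := lc_reify K l y in
      constr:(@LAdd K e1 e2)
  | (- ?x)%R => let e1 := lc_reify K l x in constr:(@LOpp K e1)
  | (?k *: ?x)%R => let e1 := lc_reify K l x in constr:(@LScale K k e1)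
  | 0%R => constr:(@LZero K)
  | _ => let n := lc_index l e in constr:(@LVar K n)
  end.

Ltac module_eq tac := lazymatch goal with
  | V : lmodType _, R : realType |- @eq _ ?x ?y =>
      let K := constr:((complex R : comNzRingType)) in
      let l1 := lc_atoms (@nil V) x in
      let l := lc_atoms l1 y in
      let e1 := lc_reify K l x in
      let e2 := lc_reify K l y in
      change (@lceval K V l e1 = @lceval K V l e2); apply: lincomb_eq;
      cbv [lccoef_eq lccoef eqn size]; repeat split; tac
  end.


(** * Discrete analytic functions, their primitives and the forward shift *)

Section DiscreteAnalytic.
Variables (R : realType) (L : rhombic_lattice R) (V : lmodType R[i]).
Local Notation C := R[i].
Local Notation vert := (vertices L).
Implicit Types (A B : set C) (c d p q u v w : C) (f g : vert -> V).

Definition vertex c (h : vertices L c) : vert := exist _ c (mem_set h).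

Lemma vertexP (x : vert) : vertices L (val x).
Proof. exact: set_mem (valP x). Qed.

(** Extension by 0 to the whole plane, since transports and sections live on all complex numbers. *)
Definition extend f c : V :=
  if pselect (vertices L c) is left h then f (vertex h) else 0.

Lemma extend_val f x : extend f (val x) = f x.
Proof.
rewrite /extend; case: pselect => [h|/(_ (vertexP x))//].
by congr f; apply: val_inj.
Qed.

Lemma extend_vertex f c (h : vertices L c) : extend f c = f (vertex h).
Proof. by rewrite -(extend_val f (vertex h)). Qed.

Lemma path_exists (a b : vert) : exists N z, path_from_to a b N z.
Proof.
pose Q c := exists2 x : vert, val x = c & exists N z, path_from_to a x N z.
suff [x e h] : Q (val b) by have <- : x = b by exact: val_inj.
apply: (@vertices_connected _ L Q (val a) (val b)); try exact: vertexP; last first.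
  by exists a => //; exists 0%N, (fun _ => a).
move=> c c' hcc' [x xc [N [z [z0 zN hz]]]].
have vc' : vertices L c' by exact: edge_vertex (edge_sym hcc').
exists (vertex vc') => //.
exists N.+1, (fun k => if (k <= N)%N then z k else vertex vc'); split=> //.
  by rewrite ltnn.
move=> k; rewrite ltnS => kN; rewrite kN.
move: kN; rewrite leq_eqVlt => /orP[/eqP ->|kN].
  by rewrite ltnn zN xc.
by rewrite kN; exact: hz.
Qed.

Lemma path_telescope (F : vert -> V) (om : C -> C -> V) a b N (z : nat -> vert) :
  (forall x y : vert, edge L (val x) (val y) -> F y - F x = om (val x) (val y)) ->
  path_from_to a b N z -> \sum_(k < N) om (val (z k)) (val (z k.+1)) = F b - F a.
Proof.
move=> hF [<- <- hz].
rewrite -(telescope_sumr (fun k => F (z k)) (leq0n N)) big_mkord.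
by apply: eq_bigr => k _; rewrite -hF//; exact: hz.
Qed.

Definition primitive f (F : vert -> V) := forall x y : vert,
  edge L (val x) (val y) -> F y - F x = ((val y - val x) / 2) *: (f x + f y).

Lemma path_integral_primitive f F a b N z : primitive f F ->
  path_from_to a b N z -> path_integral f N z = F b - F a.
Proof.
move=> hF hz; rewrite -(path_telescope (F := F)
  (om := fun c d => ((d - c) / 2) *: (extend f c + extend f d)) _ hz).
  by apply: eq_bigr => k _; rewrite !extend_val scalerA.
by move=> x y /hF ->; rewrite !extend_val.
Qed.

Lemma primitive_DA f F : primitive f F -> DA L V f.
Proof. by move=> hF a N z /(path_integral_primitive hF) ->; rewrite subrr. Qed.

Lemma primitive_integral f F a b : primitive f F -> integral f a b = F b - F a.
Proof.
move=> hF; rewrite /integral; case: xgetP => [I _ [N [z [hz ->]]]|none].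
  exact: path_integral_primitive hz.
have [N [z hz]] := path_exists a b.
by case: (none (path_integral f N z)); exists N, z.
Qed.

(** The left-hand side is twice the integral of g around the face: this is the discrete
    Cauchy-Riemann equation, a local form of being DA. *)
Definition face_closed (g : C -> V) := forall A a u v, faces L A -> rhombus A a u v ->
  (u - v) *: (g a - g (a + u + v)) + (u + v) *: (g (a + u) - g (a + v)) = 0.

Lemma DA_face_closed f : DA L V f -> face_closed (extend f).
Proof.
move=> hf A a u v fA h.
have [s1 s2 s3 s4] := rhombus_sides4 h.
have [c1 c2 c3 c4] := rhombus_corners4 h.
have vx c : rhombus_corner A c -> vertices L c by exists A.
pose z k := nth (vertex (vx _ c1))
  [:: vertex (vx _ c1); vertex (vx _ c2); vertex (vx _ c4); vertex (vx _ c3)] k.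
have hz : path_from_to (vertex (vx _ c1)) (vertex (vx _ c1)) 4 z.
  split=> // -[|[|[|[|k]]]] // _; rewrite /z /=; exists A => //; exact: rhombus_sideC.
have := hf _ _ _ hz; rewrite /path_integral !big_ord_recr big_ord0 /= /z /=.
rewrite -!extend_vertex.
move: (extend f a) (extend f (a + u)) (extend f (a + v)) (extend f (a + u + v)).
move=> x y w t e; rewrite -[RHS](scaler0 _ 2) -e.
module_eq ltac:(by field).
Qed.

(** Monodromy for the translations by the edge integrals, whose flatness is the face equation. *)
Lemma face_closed_primitive (g : C -> V) : vertices L 0 -> face_closed g ->
  exists F : C -> V, forall a b, edge L a b -> F b - F a = ((b - a) / 2) *: (g a + g b).
Proof.
move=> v0 hg.
have [||F _ hF] := @monodromy R L V (fun a b x => x + ((b - a) / 2) *: (g a + g b)) 0 0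
  _ _ v0; last by exists F => a b /hF ->; rewrite addrC addKr.
- move=> a b x _; move: (g a) (g b) => y z; module_eq ltac:(by field).
- move=> A fA; have [a [u [v h]]] := faces_rhombus fA; exists a, u, v; split=> // x.
  have := hg _ _ _ _ fA h.
  move: (g a) (g (a + u)) (g (a + v)) (g (a + u + v)) => y z t w e.
  apply/eqP; rewrite -subr_eq0; apply/eqP; rewrite -[RHS](scaler0 _ (2^-1)) -e.
  module_eq ltac:(by field).
Qed.

Lemma DA_primitive f : vertices L 0 -> DA L V f -> exists F, primitive f F.
Proof.
move=> v0 /DA_face_closed /(face_closed_primitive v0)[F hF].
by exists (fun x => F (val x)) => x y /hF ->; rewrite !extend_val.
Qed.

Lemma DA_lin k f g : DA L V f -> DA L V g -> DA L V (fun x => k *: f x + g x).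
Proof.
move=> hf hg a N z hz.
transitivity (k *: path_integral f N z + path_integral g N z); last first.
  by rewrite (hf a) // (hg a) // scaler0 addr0.
rewrite /path_integral scaler_sumr -big_split; apply: eq_bigr => j _ /=.
module_eq ltac:(ring).
Qed.

Lemma DA_scale k f : DA L V f -> DA L V (fun x => k *: f x).
Proof.
move=> hf; have := DA_lin (k - 1) hf hf; congr (DA L V _); apply/funext => x.
module_eq ltac:(ring).
Qed.

Lemma eq_by_edges (F G : vert -> V) (o : vert) : F o = G o ->
  (forall x y : vert, edge L (val x) (val y) -> F x = G x -> F y = G y) -> F = G.
Proof.
move=> e hFG; apply/funext => x.
suff : forall y : vert, val y = val x -> F y = G y by apply.
apply: (@vertices_connected _ L (fun c => forall y : vert, val y = c -> F y = G y)
  (val o) (val x)); try exact: vertexP; last first.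
  by move=> y /val_inj ->.
move=> a b hab hF y ey; subst b.
have va := edge_vertex hab.
exact: (hFG (vertex va) y hab (hF (vertex va) erefl)).
Qed.

Variable h0 : vertices L 0.
Local Notation o := (origin h0).

(** With the value 0 at the origin, these increments characterize the forward shift of a DA
    function, without path integrals. *)
Definition Zplus_step f F := forall x y : vert, edge L (val x) (val y) ->
  F y - F x = 2^-1 *: ((1 + (val y - val x)) *: f x - (1 - (val y - val x)) *: f y).

Lemma Zplus_stepP f : DA L V f -> Zplus h0 f o = 0 /\ Zplus_step f (Zplus h0 f).
Proof.
move=> /(DA_primitive h0)[F hF]; rewrite /Zplus.
split=> [|x y hxy]; rewrite !(primitive_integral _ _ hF).
  by rewrite !subrr scaler0 addr0.
transitivity (F y - F x + 2^-1 *: (f x - f y)); first by module_eq ltac:(by field).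
by rewrite hF//; module_eq ltac:(by field).
Qed.

Lemma Zplus_eq f F : DA L V f -> F o = 0 -> Zplus_step f F -> Zplus h0 f = F.
Proof.
move=> /Zplus_stepP[e hs] Fo hF; apply: (@eq_by_edges _ _ o); first by rewrite e.
move=> x y hxy exy; apply: (addIr (- F x)); rewrite hF// -[in LHS]exy; exact: hs.
Qed.

Lemma face_closed_DA f : face_closed (extend f) -> DA L V f.
Proof.
move=> /(face_closed_primitive h0)[F hF].
apply: (@primitive_DA _ (fun x => F (val x))) => x y /hF ->.
by rewrite !extend_val.
Qed.

Lemma Zplus_DA f : DA L V f -> DA L V (Zplus h0 f).
Proof.
move=> hf; apply: face_closed_DA => A a u v fA h.
have [_ hs] := Zplus_stepP hf.
have fc := DA_face_closed hf fA h.
have stp c d : rhombus_side A c d -> extend (Zplus h0 f) d =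
    extend (Zplus h0 f) c + 2^-1 *: ((1 + (d - c)) *: extend f c - (1 - (d - c)) *: extend f d).
  move=> hcd; have e : edge L c d by exists A.
  have vc := edge_vertex e; have vd := edge_vertex (edge_sym e).
  rewrite !(extend_vertex _ vc) !(extend_vertex _ vd).
  have /(congr1 (+%R (Zplus h0 f (vertex vc)))) := hs (vertex vc) (vertex vd) e.
  by rewrite addrC subrK.
have [s1 s2 s3 s4] := rhombus_sides4 h.
rewrite (stp _ _ s3) (stp _ _ s1) (stp _ _ s2).
move: fc; move: (extend f a) (extend f (a + u)) (extend f (a + v)) (extend f (a + u + v)).
move: (extend _ a) => y z t w x fc.
(* The face expression of [Zplus h0 f] is (v - 1)/2 times that of f. *)
rewrite -[RHS](scaler0 _ ((v - 1) / 2)) -fc.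
module_eq ltac:(by field).
Qed.

End DiscreteAnalytic.

(** * Sequences indexed by the integers *)

Section IntOrbits.
Variables (T : Type) (D : T -> Prop) (r : T -> T -> Prop).

Lemma int_orbit x0 :
  (forall x, D x -> exists2 y, D y & r x y) ->
  (forall y, D y -> exists2 x, D x & r x y) -> D x0 ->
  exists x : int -> T, [/\ x 0 = x0, forall k, D (x k) & forall k, r (x k) (x (k + 1))].
Proof.
move=> hr hl D0.
have : forall x, exists y, D x -> D y /\ r x y.
  by move=> x; have [/hr[y]|n] := pselect (D x); [exists y|exists x].
move=> /choice[nxt hnxt].
have : forall y, exists x, D y -> D x /\ r x y.
  by move=> y; have [/hl[x]|n] := pselect (D y); [exists x|exists y].
move=> /choice[prv hprv].
have Dn n : D (iter n nxt x0) by elim: n => //= n /hnxt[].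
have Dp n : D (iter n prv x0) by elim: n => //= n /hprv[].
(* [Negz n] is -(n + 1), hence n + 1 backward iterations. *)
exists (fun k => match k with Posz n => iter n nxt x0 | Negz n => iter n.+1 prv x0 end).
split=> // [[n|n]|[n|n]]; [exact: Dn|exact: (Dp n.+1)| |].
  by rewrite -PoszD addn1; exact: (hnxt _ (Dn n)).2.
case: n => [|n]; first exact: (hprv _ D0).2.
have -> : Negz n.+1 + 1 = Negz n by rewrite !NegzE -[in LHS]addn1 PoszD opprD subrK.
exact: (hprv _ (Dp n.+1)).2.
Qed.

Lemma int_induction (P : int -> Prop) : P 0 ->
  (forall k, P k -> P (k + 1)) -> (forall k, P (k + 1) -> P k) -> forall k, P k.
Proof.
move=> P0 up down [n|n].
  by elim: n => // n /up; rewrite -PoszD addn1.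
elim: n => [|n IH]; first exact: (down (Negz 0)).
by apply: down; rewrite [_ + 1](_ : _ = Negz n)// !NegzE -[in LHS]addn1 PoszD opprD subrK.
Qed.

End IntOrbits.

(** * Levels across ties, and the passage from one tie to the next *)

Section Levels.
Variables (R : realType) (L : rhombic_lattice R).
Local Notation C := R[i].
Variables (e : C) (n : C -> int).

Definition crossing d : int := if d == e then 1 else if d == - e then - 1 else 0.

Hypothesis e_unit : `|e| = 1.
Hypothesis nE : forall a b, edge L a b -> n b = n a + crossing (b - a).

Implicit Types (A B : set C) (a b c d p q u v w z : C) (s t : R).

Lemma dir_dt : dt e e = 1. Proof. exact/unit_normP. Qed.

Lemma dir_neq0 : e != 0.
Proof. by apply: contra_eqN e_unit => /eqP ->; rewrite normr0 eq_sym oner_eq0. Qed.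

Lemma dir_neqN : e != - e.
Proof. by rewrite -subr_eq0 opprK -mulr2n mulrn_eq0 /= dir_neq0. Qed.

Lemma crossingN d : crossing (- d) = - crossing d.
Proof.
rewrite /crossing eqr_opp -[- d == e](inj_eq oppr_inj) opprK.
have [->|_] := eqVneq d e; first by rewrite (negPf dir_neqN).
by case: eqP => _; rewrite ?opprK ?oppr0.
Qed.

Lemma crossing_e : crossing e = 1. Proof. by rewrite /crossing eqxx. Qed.

Lemma crossing0 d : d <> e -> d <> - e -> crossing d = 0.
Proof. by move=> /eqP/negPf h1 /eqP/negPf h2; rewrite /crossing h1 h2. Qed.

Lemma rhombus_crossing0 A a v : rhombus A a e v -> crossing v = 0.
Proof. by case=> _ _ h1 h2 _; apply: crossing0. Qed.

Lemma edge_unit a b : edge L a b -> `|b - a| = 1.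
Proof. by case=> A _ [v []]. Qed.

(** The levels at the four corners are compatible with an affine function, whose linear part takes
    the values [crossing u] and [crossing v] at u and v. Its slope along e is 1 if e is the
    direction of a side, and 0 otherwise. *)
Lemma face_height_ex A : faces L A -> exists l : C -> R,
  [/\ forall p q s, l (p + s%:C * (q - p)) = l p + s * (l q - l p),
      forall c, rhombus_corner A c -> l c = (n c)%:~R
    & forall p s, 0 <= s -> l p <= l (p + s%:C * e)].
Proof.
move=> fA; have [a [u [v h]]] := faces_rhombus fA; have c0 := rhombus_cr h.
have [s1 s2 s3 s4] := rhombus_sides4 h.
pose cu : R := (crossing u)%:~R; pose cv : R := (crossing v)%:~R.
pose f z : R := cr z v / cr u v * cu + cr u z / cr u v * cv.
have fD p q : f (p + q) = f p + f q by rewrite /f crDl crDr !mulrDl addrACA.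
have fN p : f (- p) = - f p by rewrite /f crNl crNr !mulNr opprD.
have fZ s p : f (s%:C * p) = s * f p by rewrite /f crZl crZr; ring.
have fu : f u = cu by rewrite /f crxx divff// !mul0r addr0 mul1r.
have fv : f v = cv by rewrite /f crxx divff// !mul0r add0r mul1r.
exists (fun z => (n a)%:~R + f (z - a)); split.
- move=> p q s; rewrite [f (q - a)]fD [f (p - a)]fD.
  rewrite [_ + _ - a]addrAC [f _]fD fZ !fD !fN; ring.
- move=> c /rhombus_cornerP[u' [v' h']].
  have nu_ : n (a + u) = n a + crossing u.
    by rewrite (nE (a := a)) ?[a + u - a]addrC ?addKr//; exists A.
  have nv : n (a + v) = n a + crossing v.
    by rewrite (nE (a := a)) ?[a + v - a]addrC ?addKr//; exists A.
  have nuv : n (a + u + v) = n a + crossing u + crossing v.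
    rewrite (nE (a := a + u)) ?nu_; last by exists A.
    by rewrite [a + u + v - _]addrC addKr.
  have [->|->|->|->] := rhombus_corner4 h h'.
  + by rewrite subrr -(subrr a) fD fN subrr addr0.
  + by rewrite nu_ [a + u - a]addrC addKr fu rmorphD.
  + by rewrite nv [a + v - a]addrC addKr fv rmorphD.
  + by rewrite nuv -[a + u + v]addrA [a + _ - a]addrC addKr fD fu fv !rmorphD addrA.
- move=> p s s0; rewrite lerD2l [p + _ - a]addrAC [f (p - a + _)]fD lerDl fZ mulr_ge0 //.
  have f1 d : crossing d = 1 -> f d = (crossing d)%:~R -> 0 <= f d by move=> -> ->.
  have [eu|/eqP ue] := eqVneq u e; first by apply: f1; rewrite ?crossing_e// -{1}eu fu /cu eu crossing_e.
  have [ev|/eqP ve] := eqVneq v e; first by apply: f1; rewrite ?crossing_e// -{1}ev fv /cv ev crossing_e.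
  have [eu|/eqP uN] := eqVneq u (- e).
    by rewrite -[e]opprK -eu fN fu /cu eu crossingN crossing_e rmorphN /= opprK.
  have [ev|/eqP vN] := eqVneq v (- e).
    by rewrite -[e]opprK -ev fN fv /cv ev crossingN crossing_e rmorphN /= opprK.
  by rewrite /f /cu /cv !crossing0 // !mulr0 addr0.
Qed.

Lemma face_heights_ex : exists l : set C -> C -> R, forall A, faces L A ->
  [/\ forall p q s, l A (p + s%:C * (q - p)) = l A p + s * (l A q - l A p),
      forall c, rhombus_corner A c -> l A c = (n c)%:~R
    & forall p s, 0 <= s -> l A p <= l A (p + s%:C * e)].
Proof.
suff : forall A, exists l : C -> R, faces L A ->
  [/\ forall p q s, l (p + s%:C * (q - p)) = l p + s * (l q - l p),
      forall c, rhombus_corner A c -> l c = (n c)%:~R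
    & forall p s, 0 <= s -> l p <= l (p + s%:C * e)].
  by move=> /choice[l hl]; exists l.
move=> A; have [fA|nA] := pselect (faces L A); last by exists (fun _ => 0).
by have [l h] := face_height_ex fA; exists l.
Qed.

(** On the common part of two faces both affine heights are determined by the levels at common
    corners, so together they form one function on the plane. The last clause is its monotonicity
    along e, carried from face to face. *)
Lemma height_line : exists l : set C -> C -> R,
 (forall A c, faces L A -> rhombus_corner A c -> l A c = (n c)%:~R) /\
 (forall A a b s, faces L A -> rhombus_corner A a -> rhombus_corner A b ->
    n a = n b -> l A (a + s%:C * (b - a)) = (n a)%:~R) /\
 (forall A B p s, faces L A -> faces L B -> A p -> B (p + s%:C * e) -> 0 <= s ->
    l A p <= l B (p + s%:C * e)).
Proof.
have [l hl] := face_heights_ex; exists l; split; last split.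
- by move=> A c /hl[_ h _]; exact: h.
- move=> A a b s /hl[h1 h2 _] Aa Ab nab.
  by rewrite h1 !h2 // nab subrr mulr0 addr0.
- have same A B p : faces L A -> faces L B -> A p -> B p -> l A p = l B p.
    move=> fA fB Ap Bp; have [<-//|AB] := pselect (A = B).
    have [hA cA _] := hl A fA; have [hB cB _] := hl B fB.
    case: (faces_meet fA fB AB Ap Bp) => [[h1 [h2 _]]|[c [d [s [h1 h2 _ -> _]]]]].
      by rewrite cA// cB.
    have [? ?] := (rhombus_side_corner h1, rhombus_side_corner (rhombus_sideC h1)).
    have [? ?] := (rhombus_side_corner h2, rhombus_side_corner (rhombus_sideC h2)).
    by rewrite hA hB !cA // !cB.
  move=> A B p s fA fB Ap Bs s0.
  pose P x := forall D, faces L D -> D (p + x%:C * e) -> l A p <= l D (p + x%:C * e).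
  suff Ps : P s by exact: Ps.
  apply: (@line_induction _ L p e s P) => // [x y x0 xy _ [D [fD Dx Dy]] Px E fE Ey|].
    have [_ _ mono] := hl D fD.
    rewrite (same E D)//; apply: le_trans (Px D fD Dx) _.
    have -> : p + y%:C * e = p + x%:C * e + (y - x)%:C * e.
      by apply: complex_eq; rewrite !ReImE; ring.
    by apply: mono; rewrite subr_ge0.
  by move=> D fD; rewrite mul0r addr0 => Dp; rewrite (same A D).
Qed.

(** Every edge has a face on each side; the sign t selects the side. *)
Lemma edge_face a b t : edge L a b -> t = 1 \/ t = -1 -> exists A v,
  [/\ faces L A, rhombus A a (b - a) v & 0 < t * cr (b - a) v].
Proof.
move=> [A fA [v h]] ht; have c0 := rhombus_cr h.
have [pos|neg] := ltP 0 (t * cr (b - a) v); first by exists A, v.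
have {}neg : t * cr (b - a) v < 0.
  by rewrite lt_def eq_sym mulf_neq0// ; case: ht => ->; rewrite ?oppr_eq0 oner_eq0.
set m := a + (2^-1)%:C * (b - a).
have half : 0 <= (2^-1 : R) <= 1.
  by rewrite invr_ge0 ler0n invf_le1 ?ltr0n ?ler1n.
have hs : rhombus_side A a b by exists v.
have Am : A m by exact: rhombus_side_mem.
have [r r0 hr] := locally_finite L m.
(* Push the midpoint m to the side missed by A. A face found there contains m, which is not a
   corner, so it has the whole edge as a side. *)
pose q := m - (r / 2)%:C * v.
have [B fB Bq] := faces_cover L q.
have Bm : B m.
  apply: hr Bq _ => //; case: (h) => _ /unit_coord_le1[h1 h2] _ _ _.
  rewrite /q /box addrC addKr !ReImE !normrN !normrM (gtr0_norm r0) [`|2^-1|]gtr0_norm ?invr_gt0//.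
  by split; nra.
have nm c : rhombus_corner A c -> c <> m.
  move=> Ac ec; have a2 : b = a + 1%:C * (b - a) by rewrite mul1r addrC subrK.
  have a1 : a = a + 0%:C * (b - a) by rewrite mul0r addr0.
  have hb : (b - a) != 0 by exact: rhombus_neq0 h.
  case: (corner_on_side Ac hs ec) => e'; move: ec; rewrite e' /m.
    rewrite [in LHS]a1 => /addrI/(mulIf hb)/complexI; lra.
  rewrite [in LHS]a2 => /addrI/(mulIf hb)/complexI; lra.
have eqm : q = a + (2^-1)%:C * (b - a) + (- (r / 2))%:C * v.
  by rewrite /q rmorphN mulNr.
have AB : A <> B.
  move=> AB; subst B; have [s1 [t1 [_ /andP[t10 _] e0]]] := rhombus_memP h Bq.
  move: e0; rewrite eqm -!addrA => /addrI /(cross_coord c0)[_]; lra.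
case: (faces_meet fA fB AB Am Bm) => [[Ac _]|[c [d [s [hA hB _ em _]]]]].
  by case: (nm _ Ac).
have hB' : rhombus_side B a b.
  case: (side_eq hs hA erefl em) => [Ac|[ec ed]|[ec ed]].
  - by case: (nm _ Ac).
  - by rewrite -ec -ed.
  - by rewrite -ec -ed; exact: rhombus_sideC.
have [w hw] := hB'; exists B, w; split=> //.
have [s1 [t1 [_ /andP[t10 _] eq1]]] := rhombus_memP hw Bq.
have gen s2 t2 x : cr (b - a) (a + s2%:C * (b - a) + t2%:C * x - a) = t2 * cr (b - a) x.
  by rewrite [_ + _ - a]addrC !addrA addNr add0r crDr !crZr crxx mulr0 add0r.
have := gen s1 t1 w; rewrite -eq1 eqm gen.
have := rhombus_cr hw; move: (cr _ w) neg => X; set Y := cr _ v => neg X0 eXY.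
have e1 : t1 * (t * X) = - (r / 2) * (t * Y) by rewrite mulrCA -eXY; ring.
have : 0 < t1 * (t * X) by rewrite e1; nra.
by move=> h3; rewrite ltNge; apply/negP => h4; nra.
Qed.

(** A tie is recorded by its lower end. [tie_step] crosses one face to the next tie of the track,
    always with increasing [cr e], which orients all tracks alike. *)
Definition tie_base P := edge L P (P + e).
Definition tie_face A P Q := [/\ faces L A, rhombus A P e (Q - P) & 0 < cr e (Q - P)].
Definition tie_step P Q := exists A, tie_face A P Q.

Lemma tie_face_corners A P Q : tie_face A P Q ->
  [/\ rhombus_side A P (P + e), rhombus_side A P Q, rhombus_side A (P + e) (Q + e)
    & rhombus_side A Q (Q + e)].
Proof.
by move=> [_ /rhombus_sides4[h1 h2 h3 h4] _]; move: h1 h2 h3 h4;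
  rewrite [P + e + _]addrAC [P + (Q - P)]addrC subrK.
Qed.

Lemma tie_step_ties P Q : tie_step P Q -> tie_base P /\ tie_base Q.
Proof.
by move=> [A hA]; have [? ? ? ?] := tie_face_corners hA; case: hA => fA _ _; split; exists A.
Qed.

Lemma tie_right P : tie_base P -> exists2 Q, tie_base Q & tie_step P Q.
Proof.
move=> tP; have [|A [v [fA]]] := edge_face (t := 1) tP; first by left.
rewrite [P + e - P]addrC addKr mul1r => h c0.
have hA : tie_face A P (P + v) by split=> //; rewrite [P + v - P]addrC addKr.
by exists (P + v); [have [] := tie_step_ties (ex_intro _ A hA)|exists A].
Qed.

Lemma tie_left Q : tie_base Q -> exists2 P, tie_base P & tie_step P Q.
Proof.
move=> tQ; have [|A [v [fA]]] := edge_face (t := -1) tQ; first by right.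
rewrite [Q + e - Q]addrC addKr mulN1r => h c0.
have hA : tie_face A (Q + v) Q.
  have ev : Q - (Q + v) = - v by rewrite opprD addrA subrr add0r.
  by split=> //; rewrite ev ?crNr//; apply: rhombus_swap; apply: rhombus_flip; exact: rhombus_swap.
by exists (Q + v); [have [] := tie_step_ties (ex_intro _ A hA)|exists A].
Qed.

Lemma tie_step_unique P Q Q' : tie_step P Q -> tie_step P Q' -> Q = Q'.
Proof.
move=> [A [fA hA cA]] [B [fB hB cB]].
set v := Q - P in hA cA; set w := Q' - P in hB cB.
have wN : cr e w != 0 by rewrite gt_eqF.
pose al := cr v w / cr e w; pose be := cr e v / cr e w.
have be0 : 0 < be by rewrite divr_gt0.
have ev : v = al%:C * e + be%:C * w by exact: cr_basis.
(* So small that P + e/2 + k v, rewritten in terms of e and w, still has coordinates in [0, 1]; both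
   faces then share three noncollinear points. *)
pose k := (4 * (1 + `|al| + be))^-1.
have al0 := normr_ge0 al.
have k0 : 0 < k by rewrite invr_gt0; lra.
have k1 : k * (4 * (1 + `|al| + be)) = 1 by rewrite mulVf// gt_eqF//; lra.
have kal : `|k * al| <= 4^-1 by rewrite normrM gtr0_norm//; nra.
have kbe : k * be <= 1 by nra.
have kbe0 : 0 <= k * be by rewrite mulr_ge0// ltW.
have kle : k <= 1 by nra.
have p0 s : 0 <= s <= 1 -> A (P + s%:C * e) /\ B (P + s%:C * e).
  move=> hs; rewrite -[P + _]addr0; split.
    by rewrite -(mul0r v); apply: (rhombus_mem hA) => //; rewrite lexx ler01.
  by rewrite -(mul0r w); apply: (rhombus_mem hB) => //; rewrite lexx ler01.
have [|A0 B0] := p0 2^-1; first by apply/andP; split; lra.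
have [|A1 B1] := p0 (2^-1 + 4^-1); first by apply/andP; split; lra.
rewrite rmorphD mulrDl addrA /= in A1 B1.
have A2 : A (P + (2^-1)%:C * e + k%:C * v).
  by apply: rhombus_mem => //; apply/andP; split; lra.
have B2 : B (P + (2^-1)%:C * e + k%:C * v).
  rewrite ev (_ : _ + _ = P + (2^-1 + k * al)%:C * e + (k * be)%:C * w); last first.
    by apply: complex_eq; rewrite !ReImE; ring.
  apply: rhombus_mem => //; last by rewrite kbe0.
  by move: kal; rewrite ler_norml; move: (k * al) => y /andP[? ?]; apply/andP; split; lra.
have AB : A = B.
  apply: (faces_inter_thin fA fB A0 A1 A2 B0 B1 B2).
  by rewrite crZl crZr gt_eqF// !mulr_gt0// invr_gt0.
subst B; have [[_ e2]|[e1 _]] := rhombus_based hA hB.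
  by move: e2; rewrite /v /w => /addIr.
by move: cA; rewrite -e1 crxx ltxx.
Qed.

End Levels.

(** * Tracks as two-sided sequences of ties *)

Section Tracks.
Variables (R : realType) (L : rhombic_lattice R).
Local Notation C := R[i].
Variables (e : C) (n : C -> int).
Hypothesis e_unit : `|e| = 1.
Hypothesis nE : forall a b, edge L a b -> n b = n a + crossing e (b - a).

Implicit Types (A B : set C) (a b c d p q u v w z : C) (s t : R).
Local Notation tie_base := (tie_base L e).
Local Notation tie_face := (tie_face L e).
Local Notation tie_step := (tie_step L e).

Lemma tie_level P : tie_base P -> n (P + e) = n P + 1.
Proof. by move=> /nE ->; rewrite [P + e - P]addrC addKr crossing_e. Qed.

Lemma tie_step_level P Q : tie_step P Q -> n Q = n P.
Proof.
move=> [A hA]; have [_ s _ _] := tie_face_corners hA; case: hA => fA h _.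
rewrite (nE (a := P)); last by exists A.
by rewrite (rhombus_crossing0 h) addr0.
Qed.

Definition orbit (x : int -> C) := forall k, tie_step (x k) (x (k + 1)).

Lemma orbit_exists P : tie_base P -> exists2 x, x 0 = P & orbit x.
Proof.
move=> tP; have [x [x0 _ hx]] := int_orbit (@tie_right _ L e) (tie_left (L := L) (e := e)) tP.
by exists x.
Qed.

Lemma orbit_tie x k : orbit x -> tie_base (x k).
Proof. by move=> /(_ k)/tie_step_ties[]. Qed.

Lemma orbit_level x k : orbit x -> n (x k) = n (x 0).
Proof.
move=> hx; move: k; apply: int_induction => // k.
  by rewrite (tie_step_level (hx k)).
by rewrite (tie_step_level (hx k)).
Qed.

Lemma tie_step_cr P Q : tie_step P Q -> cr e P < cr e Q.
Proof. by move=> [A [_ _]]; rewrite crDr crNr subr_gt0. Qed.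

(** The increment of [cr e] across a face is its area, which is bounded below, so a track is
    unbounded in both directions transversal to e. *)
Lemma orbit_spread x : orbit x -> exists2 m : R, 0 < m &
  forall k (j : nat), cr e (x k) + j%:R * m <= cr e (x (k + j%:Z)).
Proof.
move=> hx; have [m m0 hm] := faces_cr_bound L; exists m => // k.
elim=> [|j IH]; first by rewrite mul0r !addr0.
rewrite -natr1 mulrDl mul1r addrA -addn1 PoszD addrA.
have [A [fA h c0]] := hx (k + j%:Z).
have := hm _ _ _ _ fA h; rewrite gtr0_norm// crDr crNr; lra.
Qed.

Lemma orbit_lt x k l : orbit x -> k < l -> cr e (x k) < cr e (x l).
Proof.
move=> hx kl; have [m m0 h] := orbit_spread hx.
have [j ej] : exists j : nat, l = k + j.+1%:Z.
  have : 0 < l - k by rewrite subr_gt0.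
  case E : (l - k) => [[|j]|j] // _; exists j.
  by rewrite -E addrC subrK.
rewrite ej; apply: lt_le_trans (h _ _).
by rewrite ltrDl mulr_gt0.
Qed.

Lemma orbit_inj x k l : orbit x -> x k = x l -> k = l.
Proof.
move=> hx ekl; apply/eqP; rewrite eq_le; apply/andP; split; rewrite leNgt;
by apply/negP => /(orbit_lt hx); rewrite ekl ltxx.
Qed.

Lemma orbit_locate x (y : R) : orbit x ->
  exists k, cr e (x k) <= y < cr e (x (k + 1)).
Proof.
move=> hx; have [m m0 h] := orbit_spread hx.
have [j hj] : exists j : nat, cr e (x (- j%:Z)) <= y.
  exists (Num.truncn (`|cr e (x 0) - y| / m)).+1.
  set j := _.+1; have := h (- j%:Z) j; rewrite addNr => h1.
  have : `|cr e (x 0) - y| / m < j%:R by exact: truncnS_gt.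
  rewrite ltr_pdivrMr// ltr_norml => /andP[_]; lra.
have ex : exists i : nat, y < cr e (x (- j%:Z + i%:Z + 1)).
  exists (Num.truncn (`|y - cr e (x (- j%:Z))| / m)).
  set i := Num.truncn _; have := h (- j%:Z) i.+1.
  rewrite -addn1 PoszD addrA => h1.
  have : `|y - cr e (x (- j%:Z))| / m < (i + 1)%:R by rewrite addn1; exact: truncnS_gt.
  rewrite ltr_pdivrMr// ltr_norml => /andP[_]; lra.
case: (ex_minnP ex) => i hi imin; exists (- j%:Z + i%:Z); rewrite hi andbT.
case: i hi imin => [|i] hi imin; first by rewrite addr0.
rewrite leNgt; apply/negP => lt.
have := imin i; rewrite -addrA -PoszD addn1 => /(_ lt); by rewrite ltnn.
Qed.

Lemma cr_dir0 w : cr e w = 0 -> w = (dt e w)%:C * e.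
Proof.
move=> h; apply: complex_eq; rewrite !ReImE.
  transitivity (dt e e * complex.Re w); first by rewrite dir_dt ?mul1r.
  transitivity (dt e w * complex.Re e - complex.Im e * cr e w); last by rewrite h mulr0 subr0.
  by rewrite /dt /cr; ring.
transitivity (dt e e * complex.Im w); first by rewrite dir_dt ?mul1r.
transitivity (dt e w * complex.Im e + complex.Re e * cr e w); last by rewrite h mulr0 addr0.
by rewrite /dt /cr; ring.
Qed.

(** The line through p parallel to e crosses the track; the crossing point p + s e is taken on the
    lower border, between two consecutive ties. *)
Lemma orbit_vertical x p : orbit x -> exists k A s t, [/\ tie_face A (x k) (x (k + 1)),
  0 <= t < 1, p + s%:C * e = x k + t%:C * (x (k + 1) - x k)
  & cr e (x k) <= cr e p < cr e (x (k + 1))].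
Proof.
move=> hx; have [k /andP[h1 h2]] := orbit_locate (cr e p) hx.
have [A hA] := hx k; have [fA h c0] := hA.
pose t := (cr e p - cr e (x k)) / cr e (x (k + 1) - x k).
have ht : t * cr e (x (k + 1) - x k) = cr e p - cr e (x k) by rewrite divfK ?gt_eqF.
pose Q := x k + t%:C * (x (k + 1) - x k).
have : cr e (Q - p) = 0.
  by rewrite crDr [cr e Q]crDr crZr ht crNr; lra.
move=> /cr_dir0 eQ; exists k, A, (dt e (Q - p)), t; split=> //; last by rewrite h1.
  apply/andP; split; first by apply: divr_ge0; [rewrite subr_ge0|exact: ltW].
  by rewrite ltr_pdivrMr// mul1r crDr crNr ltrD2r.
by rewrite -eQ addrC subrK.
Qed.

(* Along a line parallel to e the level can only grow, by one across each
   track, so distinct tracks met by the line have distinct levels. *)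
Lemma same_level_same_orbit x P : orbit x -> tie_base P -> n P = n (x 0) ->
  exists k, P = x k.
Proof.
move=> hx tP nP; have [l [lc [lseg lmono]]] := height_line e_unit nE.
have [k [A [s [t [hA /andP[t0 t1] eQ /andP[X0 X1]]]]]] := orbit_vertical P hx.
have nk := orbit_level k hx; have nk1 := orbit_level (k + 1) hx.
have tk := tie_level (orbit_tie k hx); have tk1 := tie_level (orbit_tie (k + 1) hx).
have [s1 s2 s3 s4] := tie_face_corners hA; have [fA h c0] := hA.
set Q := P + s%:C * e in eQ; set v := x (k + 1) - x k in eQ h c0.
have ht : 0 <= t <= 1 by rewrite t0 ltW.
have [B fB sB] := tP.
have lP : l B P = (n P)%:~R by rewrite lc//; exact: rhombus_side_corner sB.
have lPe : l B (P + e) = (n P + 1)%:~R.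
  by rewrite lc ?tie_level//; exact: rhombus_side_corner (rhombus_sideC sB).
have lQ : l A Q = (n P)%:~R.
  rewrite eQ lseg ?nk ?nk1 //; [by rewrite nP|exact: rhombus_side_corner s1|].
  exact: rhombus_side_corner (rhombus_sideC s2).
have eQe : Q + e = x k + e + t%:C * (x (k + 1) + e - (x k + e)).
  by rewrite eQ /v; apply: complex_eq; rewrite !ReImE; ring.
have lQe : l A (Q + e) = (n P + 1)%:~R.
  rewrite eQe lseg ?tk ?tk1 ?nk ?nk1 //; [by rewrite nP|exact: rhombus_side_corner s3|].
  exact: rhombus_side_corner (rhombus_sideC s3).
have memA r : 0 <= r <= 1 -> A (Q + r%:C * e).
  by move=> hr; rewrite eQ addrAC; exact: rhombus_mem.
have memB r : 0 <= r <= 1 -> B (P + r%:C * e).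
  move=> hr; have := rhombus_side_mem sB hr.
  by rewrite [P + e - P]addrC addKr.
have [r0 r1] : (0 : R) <= 0 <= (1 : R) /\ (0 : R) <= 1 <= (1 : R) by rewrite !lexx !ler01.
have [A0 A1] := (memA _ r0, memA _ r1); rewrite mul0r addr0 mul1r in A0 A1.
have [B0 B1] := (memB _ r0, memB _ r1); rewrite mul0r addr0 mul1r in B0 B1.
have lt1 : (n P)%:~R < (n P + 1)%:~R :> R by rewrite ltr_int ltzD1.
(* If |s| were at least 1, the line would climb from height n P + 1 back to height n P. So the
   segments from P to P + e and from Q to Q + e overlap. *)
have [sge|slt] := leP 1 s.
  have := lmono B A (P + e) (s - 1) fB fA B1.
  have -> : P + e + (s - 1)%:C * e = Q.
    by rewrite /Q; apply: complex_eq; rewrite !ReImE; ring.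
  by rewrite subr_ge0 lPe lQ => /(_ A0 sge); rewrite leNgt lt1.
have [sle|sgt] := leP s (- 1).
  have := lmono A B (Q + e) (- s - 1) fA fB A1.
  have -> : Q + e + (- s - 1)%:C * e = P.
    by rewrite /Q; apply: complex_eq; rewrite !ReImE; ring.
  have s' : 0 <= - s - 1 by lra.
  by rewrite lQe lP => /(_ B0 s'); rewrite leNgt lt1.
(* Of the four corners of A, the upper two have the wrong level and x (k + 1) has too large a
   [cr e]. *)
suff cP : rhombus_corner A P.
  have [u' [w' h']] := (rhombus_cornerP A P).1 cP.
  have xv : x k + v = x (k + 1) by rewrite addrC subrK.
  have [e1|e1|e1|e1] := rhombus_corner4 h h'.
  - by exists k.
  - by move: nP; rewrite e1 tk nk => /eqP; rewrite -[X in _ == X]addr0 (inj_eq (addrI _)).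
  - by move: X1; rewrite e1 xv ltxx.
  - by move: nP; rewrite e1 [_ + e + v]addrAC xv tk1 nk1 => /eqP; rewrite -[X in _ == X]addr0 (inj_eq (addrI _)).
(* The midpoint y of the overlap is interior to the tie at P, so A and B, both containing y, share
   that tie or coincide. *)
pose mu := (1 + s) / 2; pose y := P + mu%:C * e.
have hmu : 0 < mu < 1 by apply/andP; split; rewrite /mu; lra.
have By : B y by apply: memB; case/andP: hmu => ? ?; rewrite !ltW.
have Ay : A y.
  have -> : y = Q + (mu - s)%:C * e.
    by rewrite /y /Q; apply: complex_eq; rewrite !ReImE; ring.
  by apply: memA; apply/andP; split; rewrite /mu; lra.
have ey : y = P + mu%:C * (P + e - P) by rewrite [P + e - P]addrC addKr.
have ny : ~ rhombus_corner B y.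
  move=> cy; case: (corner_on_side cy sB ey); rewrite /y.
    move/eqP; rewrite -[X in _ == X]addr0 (inj_eq (addrI _)) mulf_eq0.
    by rewrite (negPf (dir_neq0 e_unit)) fmorph_eq0 orbF; case/andP: hmu => /gt_eqF->.
  move/addrI; rewrite -[X in _ = X]mul1r => /(mulIf (dir_neq0 e_unit))/complexI.
  by case/andP: hmu => _ /lt_eqF /eqP.
have [AB|AB] := pselect (A = B).
  by rewrite AB; exact: rhombus_side_corner sB.
case: (faces_meet fA fB AB Ay By) => [[_ [cy _]]//|[c [d [r [hAc hBc _ ey' _]]]]].
case: (side_eq sB hBc ey ey') => [//|[ec ed]|[ec ed]].
  by rewrite -ec; exact: rhombus_side_corner hAc.
by rewrite -ed; exact: rhombus_side_corner (rhombus_sideC hAc).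
Qed.

Lemma common_side_unique A B a b c d : faces L A -> faces L B -> A <> B ->
  common_side A B a b -> common_side A B c d ->
  (c = a /\ d = b) \/ (c = b /\ d = a).
Proof.
move=> fA fB AB [ha hb] [hc hd].
have mem (D : set C) (k l : C) : rhombus_side D k l -> D k /\ D l.
  by move=> h; split; apply: rhombus_corner_mem; [exact: rhombus_side_corner h|
    exact: rhombus_side_corner (rhombus_sideC h)].
have neq (D : set C) (k l : C) : rhombus_side D k l -> k <> l.
  by move=> [w /rhombus_neq0]; rewrite subr_eq0 => /eqP h e'; apply: h.
have [Aa Ab] := mem _ _ _ ha; have [Ba Bb] := mem _ _ _ hb.
have [Ac Ad] := mem _ _ _ hc; have [Bc Bd] := mem _ _ _ hd.
case: (faces_meet fA fB AB Aa Ba) => [[_ [_ h]]|[k [l [s [hA hB _ _ h]]]]].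
  by case: (neq _ _ _ ha); rewrite [b]h.
have ends w : rhombus_corner A w -> A w -> B w -> w = k \/ w = l.
  by move=> cw Aw Bw; have [s' _ e'] := h _ Aw Bw; exact: corner_on_side cw hA e'.
have e1 := ends a (rhombus_side_corner ha) Aa Ba.
have e2 := ends b (rhombus_side_corner (rhombus_sideC ha)) Ab Bb.
have e3 := ends c (rhombus_side_corner hc) Ac Bc.
have e4 := ends d (rhombus_side_corner (rhombus_sideC hc)) Ad Bd.
have n1 := neq _ _ _ ha; have n2 := neq _ _ _ hc.
by case: e1 n1 => ->; case: e2 => -> // n1; case: e3 n2 => ->; case: e4 => -> // n2; auto.
Qed.

(** F k lies between the ties at x k and x (k + 1), so the tie at x k is the side shared by F (k -
    1) and F k. *)
Lemma orbit_track x : orbit x -> exists F, track L F /\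
  forall k, common_side (F (k - 1)) (F k) (x k) (x k + e).
Proof.
move=> hx.
have [F hF] := choice hx.
have cs k : common_side (F (k - 1)) (F k) (x k) (x k + e).
  have [_ _ _ s4] := tie_face_corners (hF (k - 1)).
  have [s1 _ _ _] := tie_face_corners (hF k).
  by split=> //; move: s4; rewrite subrK.
(* [cr e] strictly increases along x, but takes only two values on the corners of F (k - 1). *)
have neq k : F (k - 1) <> F k.
  move=> E; have [_ _ _ s4] := tie_face_corners (hF k).
  have [_ h c0] := hF (k - 1); rewrite E subrK in h c0.
  have [u' [w' h']] := (rhombus_cornerP _ _).1 (rhombus_side_corner s4).
  have X1 := tie_step_cr (hx (k - 1)); have X2 := tie_step_cr (hx k).
  rewrite subrK in X1.
  have ex : x (k - 1) + (x k - x (k - 1)) = x k by rewrite addrC subrK.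
  have := rhombus_corner4 h h'; rewrite [x (k - 1) + e + _]addrAC ex => -[] E';
    move: X2; rewrite E' ?crDr ?crxx ?addr0; lra.
exists F; split=> // k; split.
- by have [] := hF k.
- have := neq (k + 1); rewrite addrK => nq; split=> //.
  by exists (x (k + 1)), (x (k + 1) + e); have := cs (k + 1); rewrite addrK.
- move=> a b c d hab hcd.
  have [fk h c0] := hF k; have [fk1 _ _] := hF (k - 1); have [fk2 _ _] := hF (k + 1).
  have nq := neq (k + 1); have cs1 := cs (k + 1); rewrite addrK in nq cs1.
  have xk : x k + (x (k + 1) - x k) = x (k + 1) by rewrite addrC subrK.
  have hN := rhombus_flip h.
  have k1 : x k + e - x k = e by rewrite addrC addKr.
  have k2 : x k - (x k + e) = - e by rewrite opprD addrA subrr add0r.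
  have xke : x k + e + (x (k + 1) - x k) = x (k + 1) + e by rewrite addrAC xk.
  case: (common_side_unique fk1 fk (@neq k) (cs k) hab) => -[-> ->];
  case: (common_side_unique fk fk2 nq cs1 hcd) => -[-> ->];
  exists (x (k + 1) - x k); rewrite ?k1 ?k2 //; rewrite xk xke; auto.
Qed.

Hypothesis hL : coherent_tracks_on_both_sides L.

(** On the side of the track containing P + e the level never falls below n P + 1, and by the
    standing assumption this side contains a coherent track, whose ties are parallel to e. *)
Lemma tie_next_level P : tie_base P -> exists2 P', tie_base P' & n P + 1 <= n P'.
Proof.
move=> tP; have [x x0 hx] := orbit_exists tP.
have [F [trF hF]] := orbit_track hx.
have tieF k : tie F (x k) (x k + e).
  by exists (k - 1); rewrite subrK; exact: hF.
have vPe : vertices L (P + e) by exact: edge_vertex (edge_sym tP).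
pose K := [set y : vertices L | exists N (z : nat -> vertices L), [/\ z 0%N = vertex vPe, z N = y
  & walk (fun a b => edge L a b /\ ~ tie F a b) N z]].
have sK : track_side F K by exists (vertex vPe).
have [G [trG GK coh]] := hL trF sK.
have levelK y : K y -> n P + 1 <= n (val y).
  move=> [N [z [z0 <- hz]]].
  suff : forall k, (k <= N)%N -> n P + 1 <= n (val (z k)) by apply.
  elim=> [|k IH] kN; first by rewrite z0 /= tie_level.
  have {IH} := IH (ltnW kN); have [hzk nt] := hz k kN.
  (* A step lowers the level by at most one, so only a descent from level n P + 1 must be excluded.
     It would cross a tie of level n P, which belongs to the same track. *)
  rewrite (nE hzk) le_eqVlt => /orP[/eqP ek|lt]; last first.
    rewrite -lezD1 in lt; apply: le_trans (_ : n (val (z k)) - 1 <= _).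
      by rewrite lerBrDr.
    by rewrite lerD2l /crossing; case: eqP => // _; case: eqP.
  rewrite ek lerDl /crossing; case: eqP => // _; case: eqP => // eN.
  have ezk : val (z k.+1) + e = val (z k).
    by rewrite -[e]opprK -eN opprB addrC subrK.
  have tz : tie_base (val (z k.+1)) by rewrite /tie_base ezk; exact: edge_sym.
  have nz : n (val (z k.+1)) = n (x 0).
    by apply: (addIr 1); rewrite -(tie_level tz) ezk -ek x0.
  have [j ej] := same_level_same_orbit hx tz nz.
  case: nt; have [i [h1 h2]] := tieF j; exists i.
  by rewrite -ej ezk in h1 h2; split; exact: rhombus_sideC.
have [fG [_ [c [d [hc hc1]]]] _] := trG 0.
have [r er] : parallel e (d - c).
  have := coh (x 0) (x 0 + e) c d (tieF 0); rewrite [_ + e - _]addrC addKr.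
  by apply; exists 0.
have ecd : edge L c d by exists (G 0).
have GKc a : rhombus_corner (G 0) a -> n P + 1 <= n a.
  move=> ca; have va : vertices L a by exists (G 0).
  by apply: (levelK (vertex va)); exact: (GK 0).
have r1 : r ^+ 2 = 1.
  have /unit_normP := edge_unit ecd; rewrite er.
  have := dir_dt e_unit; rewrite /dt !ReImE => h; nra.
have : (r == 1) || (r == -1) by rewrite -sqrf_eq1 r1.
case/orP => /eqP r'; move: er; rewrite r' ?rmorphN ?rmorph1 ?mulN1r ?mul1r => er.
  exists c; last exact: GKc (rhombus_side_corner hc).
  by rewrite /tie_base -er [c + _]addrC subrK.
exists d; last exact: GKc (rhombus_side_corner (rhombus_sideC hc)).
by rewrite /tie_base -[e]opprK -er opprB [d + _]addrC subrK; exact: edge_sym.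
Qed.

Lemma tie_high k P : tie_base P -> exists2 P', tie_base P' & k <= n P'.
Proof.
move=> tP; have up (j : nat) : exists2 P', tie_base P' & n P + j%:Z <= n P'.
  elim: j => [|j [P' tP' h]]; first by exists P; rewrite ?addr0.
  have [P2 tP2 h2] := tie_next_level tP'; exists P2 => //.
  by apply: le_trans h2; rewrite -addn1 PoszD addrA lerD2r.
have [P' tP' h] := up `|k - n P|%N; exists P' => //.
by apply: le_trans h; rewrite -lerBlDl abszE ler_norm.
Qed.

End Tracks.

(** * Every vertex is reached from ties along edges not parallel to e *)

Section Reach.
Variables (R : realType) (L : rhombic_lattice R).
Local Notation C := R[i].
Variables (e : C) (n : C -> int).
Hypothesis e_unit : `|e| = 1.
Hypothesis nE : forall a b, edge L a b -> n b = n a + crossing e (b - a).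
Hypothesis hL : coherent_tracks_on_both_sides L.
Hypothesis he : edge_directions L e.

Implicit Types (A B : set C) (a b c d p q u v w z : C) (s t : R).
Local Notation tie_base := (tie_base L e).
Local Notation tie_face := (tie_face L e).
Local Notation tie_step := (tie_step L e).

Lemma tie_base_exists : exists P, tie_base P.
Proof.
by case: he => [a [b [hab E]]]; exists a; rewrite /tie_base E [a + _]addrC subrK.
Qed.

Lemma rhombus_dir_cases A : faces L A ->
  (exists P v, rhombus A P e v) \/
  (forall a b, rhombus_side A a b -> b - a <> e /\ b - a <> - e).
Proof.
move=> fA; have [|none] := pselect (exists P v, rhombus A P e v); first by left.
right=> a b hab; split=> [E|E]; apply: none.
  by case: hab => v; rewrite E => h; exists a, v.
by case: (rhombus_sideC hab) => v; rewrite -opprB E opprK => h; exists b, v.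
Qed.

(* If Q fails at z, follow the ray from z along e: failure spreads through the
   faces met, until the first face having e as a side, whose two lower corners
   satisfy Q. *)
Lemma reach_tie (Q : C -> Prop) :
  (forall P, tie_base P -> Q P) ->
  (forall a b, edge L a b -> b - a <> e -> b - a <> - e -> Q a -> Q b) ->
  forall z, vertices L z -> Q z.
Proof.
move=> Qtie Qedge z vz; apply: contrapT => nQz.
have nedge a b : edge L a b -> b - a <> e -> b - a <> - e -> ~ Q a -> ~ Q b.
  move=> hab h1 h2 nQ Qb; apply: nQ; apply: (Qedge b a) => //; first exact: edge_sym.
    by move=> E; apply: h2; rewrite -opprB E.
  by move=> E; apply: h1; rewrite -opprB E opprK.
(* How failure enters a face A at a point p: through a corner, or through a side with both ends
   failing. *)
pose bad A p := rhombus_corner A p /\ ~ Q p \/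
  exists c d s, [/\ rhombus_side A c d, p = c + s%:C * (d - c), ~ Q c & ~ Q d].
pose all_bad A := forall c, rhombus_corner A c -> ~ Q c.
have bad_upper A P v p : faces L A -> rhombus A P e v -> bad A p ->
    exists t, p = P + e + t%:C * v.
  move=> fA h hb; have [s1 s2 s3 s4] := rhombus_sides4 h.
  have QP : Q P by apply: Qtie; exists A.
  have QPv : Q (P + v) by apply: Qtie; exists A; rewrite // addrAC.
  have upper c : rhombus_corner A c -> ~ Q c -> c = P + e \/ c = P + e + v.
    move=> /rhombus_cornerP[u' [v' h']] nQ.
    have [E|E|E|E] := rhombus_corner4 h h'; [|by left| |by right].
      by rewrite E in nQ.
    by rewrite E in nQ.
  have to c : c = P + e \/ c = P + e + v -> exists t, c = P + e + t%:C * v.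
    by case=> ->; [exists 0|exists 1]; rewrite ?mul0r ?addr0 ?mul1r.
  case: hb => [[cp nQ]|[c [d [s [hcd ep nc nd]]]]]; first by apply: to; exact: upper.
  have [t1 ec] := to c (upper c (rhombus_side_corner hcd) nc).
  have [t2 ed] := to d (upper d (rhombus_side_corner (rhombus_sideC hcd)) nd).
  exists (t1 + s * (t2 - t1)); rewrite ep ec ed.
  by apply: complex_eq; rewrite !ReImE; ring.
have share A B p : faces L A -> faces L B -> A p -> B p -> all_bad A ->
    all_bad B \/ bad B p.
  move=> fA fB Ap Bp hA; have [<-|AB] := pselect (A = B); first by left.
  right; case: (faces_meet fA fB AB Ap Bp) => [[cA [cB _]]|[c [d [s [hAc hBc _ E _]]]]].
    by left; split=> //; exact: hA.
  right; exists c, d, s; split=> //; apply: hA; first exact: rhombus_side_corner hAc.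
  exact: rhombus_side_corner (rhombus_sideC hAc).
(* Invariant along the ray: apart from the start, the point lies in some face at all of whose
   corners [Q] fails. *)
pose S s := s = 0 \/ exists A, [/\ faces L A, A (z + s%:C * e) & all_bad A].
have badS B s : faces L B -> B (z + s%:C * e) -> S s ->
    all_bad B \/ bad B (z + s%:C * e).
  move=> fB Bs [s0|[A [fA As hA]]]; last exact: share fA fB As Bs hA.
  rewrite s0 mul0r addr0 in Bs *; right; left; split=> //.
  exact: (vertex_corner vz fB Bs).
have step x y : 0 <= x -> x <= y ->
    (exists B, [/\ faces L B, B (z + x%:C * e) & B (z + y%:C * e)]) -> S x -> S y.
  move=> x0; rewrite le_eqVlt => /orP[/eqP->//|xy] [B [fB Bx By]] Sx.
  right; exists B; split=> //; case: (badS B x fB Bx Sx) => // hb.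
  (* If e is a side of B, failure can enter B only on its upper side, from which going on along e
     leaves B; otherwise it spreads to all corners of B. *)
  case: (rhombus_dir_cases fB) => [[P [v h]]|nodir].
    exfalso; have [t et] := bad_upper B P v _ fB h hb.
    have [s' [t' [/andP[_ s1] _]]] := rhombus_memP h By.
    have -> : z + y%:C * e = P + (1 + (y - x))%:C * e + t%:C * v.
      transitivity (z + x%:C * e + (y - x)%:C * e).
        by apply: complex_eq; rewrite !ReImE; ring.
      by rewrite et; apply: complex_eq; rewrite !ReImE; ring.
    rewrite -!addrA => /addrI /(cross_coord (rhombus_cr h))[E _].
    by move: s1; rewrite -E; apply/negP; rewrite -ltNge; lra.
  have spread c c' : rhombus_corner B c -> rhombus_corner B c' -> ~ Q c -> ~ Q c'.
    apply: (rhombus_corners_connected (Q := fun c => ~ Q c)) => a b hab.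
    by have [h1 h2] := nodir a b hab; apply: nedge => //; exists B.
  move=> c cB; case: hb => [[cp nQ]|[c' [d [s [hcd _ nc _]]]]]; first exact: spread nQ.
  exact: spread (rhombus_side_corner hcd) cB nc.
have [P0 tP0] := tie_base_exists.
(* A track of level above n z must be crossed by the ray at some s >= 0, because heights do not
   decrease along e. *)
have [P tP hP] := tie_high e_unit nE hL (n z + 1) tP0.
have [x x0 hx] := orbit_exists tP.
have [l [lc [lseg lmono]]] := height_line e_unit nE.
have [k [A [s [t [hA /andP[t0 t1] eQ _]]]]] := orbit_vertical e_unit z hx.
have [s1 s2 s3 s4] := tie_face_corners hA; have [fA h c0] := hA.
have nk := orbit_level nE k hx; have nk1 := orbit_level nE (k + 1) hx.
have AQ : A (z + s%:C * e).
  by rewrite eQ; apply: (rhombus_side_mem s2); rewrite t0 ltW.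
have lQ : l A (z + s%:C * e) = (n P)%:~R.
  rewrite eQ lseg ?nk ?nk1 ?x0 //; first exact: rhombus_side_corner s1.
  exact: rhombus_side_corner (rhombus_sideC s2).
have s0 : 0 <= s.
  rewrite leNgt; apply/negP => sneg.
  have [B fB Bz] := vz.
  have := lmono A B (z + s%:C * e) (- s) fA fB AQ.
  rewrite -addrA -mulrDl -rmorphD subrr mul0r addr0 lQ lc// oppr_ge0 ler_int.
  move=> /(_ (rhombus_corner_mem Bz) (ltW sneg)); rewrite leNgt => /negP; apply.
  by apply: lt_le_trans hP; rewrite ltzD1.
have Ss : S s.
  by apply: (@line_induction _ L z e s S) => // [a b a0 ab _|]; [exact: step|left].
case: (badS A s fA AQ Ss) => hb.
  by case: (hb (x k)); [exact: rhombus_side_corner s1|apply: Qtie; exact: orbit_tie].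
(* The crossing point is on the lower side of A, while failure is possible only on the upper one. *)
have [t' et] := bad_upper A _ _ _ fA h hb.
have : 0%:C * e + t%:C * (x (k + 1) - x k) = 1%:C * e + t'%:C * (x (k + 1) - x k).
  by apply: (addrI (x k)); rewrite mul0r add0r -eQ et mul1r addrA.
by move=> /(cross_coord (rhombus_cr h))[/esym/eqP]; rewrite oner_eq0.
Qed.

End Reach.

(** * Solving the edge equation for a direction e *)

Section Inversion.
Variables (R : realType) (L : rhombic_lattice R).
Local Notation C := R[i].
Variables (e : C) (n : C -> int).
Hypothesis e_unit : `|e| = 1.
Hypothesis nE : forall a b, edge L a b -> n b = n a + crossing e (b - a).
Variables (V : lmodType C) (G : C -> V).
Hypothesis hG : face_closed L G.
Hypothesis v0 : vertices L 0.

Implicit Types (A B : set C) (a b c d p q u v w z : C) (s t : R).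
Local Notation tie_base := (tie_base L e).
Local Notation tie_face := (tie_face L e).
Local Notation tie_step := (tie_step L e).

(* The translation by which a tie must act at Q, given that the tie at P acts by
   y, for edge_map below to have trivial monodromy around the face P, P + e,
   Q + e, Q. *)
Definition jump_step P Q (y : V) : V :=
  (e - (Q - P))^-1 *: ((e + (Q - P)) *: y - G (Q + e) + G (P + e) + G Q - G P).

Lemma tie_step_neq P Q : tie_step P Q -> e - (Q - P) != 0 /\ e + (Q - P) != 0.
Proof.
move=> [A [_ [_ _ h1 h2 _] _]]; split.
  by rewrite subr_eq0 eq_sym; apply/eqP.
by rewrite addrC addr_eq0; apply/eqP.
Qed.

Lemma jumps_exist : exists sg : C -> V, forall P Q, tie_step P Q ->
  sg Q = jump_step P Q (sg P).
Proof.
(* Follow the track of level k with pairs of a tie and its translation. The initial translation 0 is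
   arbitrary, and [jump_step] is invertible, so the sequence extends both ways. *)
have orbits (k : int) : exists x : int -> C * V, (exists2 P, tie_base P & n P = k) ->
    [/\ orbit L e (fun j => (x j).1), n (x 0).1 = k &
        forall j, (x (j + 1)).2 = jump_step (x j).1 (x (j + 1)).1 (x j).2].
  have [[P tP nP]|none] := pselect (exists2 P, tie_base P & n P = k); last first.
    by exists (fun _ => (0, 0)).
  have [||x [x0 _ hx]] := @int_orbit (C * V)%type (fun y => tie_base y.1)
    (fun y y' => tie_step y.1 y'.1 /\ y'.2 = jump_step y.1 y'.1 y.2) (P, 0) _ _ tP.
  - move=> [P1 y] /tie_right[Q tQ hPQ]; by exists (Q, jump_step P1 Q y).
  - move=> [Q y] /tie_left[P1 tP1 hPQ].
    exists (P1, (e + (Q - P1))^-1 *: ((e - (Q - P1)) *: y + G (Q + e) - G (P1 + e) - G Q + G P1)) => //.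
    split=> //=; rewrite /jump_step; have [h1 h2] := tie_step_neq hPQ.
    move: (G (Q + e)) (G (P1 + e)) (G Q) (G P1) (e - (Q - P1)) (e + (Q - P1)) h1 h2.
    move=> g1 g2 g3 g4 c1 c2 h1 h2.
    module_eq ltac:(by field; rewrite ?h1 ?h2).
  exists x => _; split; [by move=> j; exact: (hx j).1|by rewrite x0|].
  by move=> j; exact: (hx j).2.
have [X hX] := choice orbits.
have onorbit P : tie_base P -> exists j, P = (X (n P) j).1.
  move=> tP; have [|ox nx _] := hX (n P); first by exists P.
  by apply: (same_level_same_orbit e_unit nE ox tP); rewrite nx.
have [sg hsg] : exists sg : C -> V, forall P, tie_base P ->
    exists2 j, P = (X (n P) j).1 & sg P = (X (n P) j).2.
  have : forall P, exists y, tie_base P -> exists2 j, P = (X (n P) j).1 & y = (X (n P) j).2.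
    move=> P; have [/onorbit[j ej]|nt] := pselect (tie_base P); last by exists 0.
    by exists (X (n P) j).2 => _; exists j.
  by move=> /choice[sg h]; exists sg.
exists sg => P Q hPQ; have [tP tQ] := tie_step_ties hPQ.
have [j eP ->] := hsg P tP; have [j' eQ ->] := hsg Q tQ.
have nQ := tie_step_level nE hPQ.
have [|ox nx st] := hX (n P); first by exists P.
rewrite nQ in eQ *.
have Qj : Q = (X (n P) (j + 1)).1.
  by apply: (tie_step_unique hPQ); have := ox j; rewrite -eP.
(* The ties of an orbit are distinct, so a tie determines its index. *)
have jj : j' = j + 1 by apply: (orbit_inj ox); rewrite -eQ -Qj.
by rewrite jj st -eP -Qj.
Qed.

(** On a tie the coefficient of the upper value vanishes and the equation reads 2 e f(P) = G(P + e)
    - G(P). *)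
Definition forced P : V := (2 * e)^-1 *: (G (P + e) - G P).

Lemma tie_step_closed P Q : tie_step P Q ->
  (e - (Q - P)) *: (G P - G (Q + e)) + (e + (Q - P)) *: (G (P + e) - G Q) = 0.
Proof.
move=> [A [fA h _]]; have := hG fA h.
by rewrite [P + (Q - P)]addrC subrK [P + e + _]addrAC [P + (Q - P)]addrC subrK.
Qed.

Lemma dir2_neq0 : 2 * e != 0.
Proof. by rewrite mulf_neq0 ?pnatr_eq0// dir_neq0. Qed.

Lemma forced_step P Q : tie_step P Q ->
  (e - (Q - P)) *: forced Q = (e + (Q - P)) *: forced P - (G Q - G P).
Proof.
move=> hPQ; have h := tie_step_closed hPQ; have [h1 h2] := tie_step_neq hPQ.
have e2 := dir2_neq0; have e1 := dir_neq0 e_unit.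
apply/eqP; rewrite -subr_eq0; apply/eqP; rewrite -[RHS](scaler0 _ (- (2 * e)^-1)) -h /forced.
move: (G (P + e)) (G (Q + e)) (G P) (G Q) (Q - P) => g1 g2 g3 g4 d.
module_eq ltac:(by field; rewrite ?e1).
Qed.

(** Off the ties this is the edge equation solved for f(b). On a tie that equation leaves f(b) free
    or does not involve f(a), so a translation takes its place. *)
Definition edge_map (sg : C -> V) a b (x : V) : V :=
  if b - a == e then x + sg a else if b - a == - e then x - sg b
  else (e - (b - a))^-1 *: ((e + (b - a)) *: x - (G b - G a)).

Lemma edge_map_dir sg P x : edge_map sg P (P + e) x = x + sg P.
Proof. by rewrite /edge_map [P + e - P]addrC addKr eqxx. Qed.

Lemma edge_map_other sg a b x : b - a <> e -> b - a <> - e ->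
  edge_map sg a b x = (e - (b - a))^-1 *: ((e + (b - a)) *: x - (G b - G a)).
Proof. by move=> /eqP/negPf h1 /eqP/negPf h2; rewrite /edge_map h1 h2. Qed.

Lemma other_neq0 d : d <> e -> d <> - e -> e - d != 0 /\ e + d != 0.
Proof.
move=> /eqP h1 /eqP h2; split; first by rewrite subr_eq0 eq_sym.
by rewrite addrC addr_eq0.
Qed.

Lemma edge_mapK sg a b x : edge_map sg b a (edge_map sg a b x) = x.
Proof.
have eN := negPf (dir_neqN e_unit); have eN' : (- e == e) = false by rewrite eq_sym.
rewrite /edge_map -[a - b]opprB eqr_oppLR eqr_opp.
have [->|/eqP h1] := eqVneq (b - a) e; first by rewrite eN addrK.
have [_|/eqP h2] := eqVneq (b - a) (- e); first by rewrite subrK.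
have [c1 c2] := other_neq0 h1 h2.
move: (G a) (G b) (b - a) c1 c2 => g1 g2 d c1 c2.
rewrite !opprK.
module_eq ltac:(by field; rewrite ?c1 ?c2).
Qed.

Lemma sections_exist z (t0 : V) sg : (forall P Q, tie_step P Q ->
    sg Q = jump_step P Q (sg P)) -> vertices L z ->
  exists2 f : C -> V, f z = t0 & forall a b, edge L a b -> f b = edge_map sg a b (f a).
Proof.
move=> hsg vz; apply: monodromy => // [a b x _|A fA]; first exact: edge_mapK.
have [[P [v h]]|nodir] := pselect (exists P v, rhombus A P e v).
  (* Orient the face so that P and P + v are consecutive ties; flatness is then the recursion
     defining sg. *)
  have : exists P v, rhombus A P e v /\ 0 < cr e v.
    have := rhombus_cr h; rewrite neq_lt => /orP[neg|pos]; last by exists P, v.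
    exists (P + v), (- v); rewrite crNr oppr_gt0; split=> //.
    exact/rhombus_swap/rhombus_flip/rhombus_swap.
  move=> {h}[{}P [{}v [h c0]]]; exists P, e, v; split=> // x.
  have hPQ : tie_step P (P + v) by exists A; split=> //; rewrite [P + v - P]addrC addKr.
  have [h1 h2] := tie_step_neq hPQ; have := hsg _ _ hPQ.
  rewrite /jump_step [P + v - P]addrC addKr in h1 h2 *.
  case: (h) => _ _ vn vN _.
  rewrite edge_map_dir edge_map_other ?[P + e + v]addrAC; last 2 first.
  - by rewrite opprD addrACA subrr addr0 addrC addKr.
  - by rewrite opprD addrACA subrr addr0 addrC addKr.
  rewrite edge_map_dir edge_map_other ?[P + v - P]addrC ?addKr // => ->.
  rewrite (_ : P + v + e - (P + e) = v); last by rewrite opprD addrACA subrr addr0 addrC addKr.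
  move: (G (P + v + e)) (G (P + e)) (G (P + v)) (G P) (sg P) => g1 g2 g3 g4 y.
  module_eq ltac:(by field; rewrite ?h1).
have [a [u [v h]]] := faces_rhombus fA; exists a, u, v; split=> // x.
have nd a' u' v' : rhombus A a' u' v' -> u' <> e /\ u' <> - e.
  move=> h'; split=> E; apply: nodir; first by exists a', v'; rewrite -E.
  by exists (a' + u'), v'; rewrite -[e]opprK -E; exact: rhombus_flip.
have [u1 u2] := nd _ _ _ h; have [v1 v2] := nd _ _ _ (rhombus_swap h).
have [cu1 cu2] := other_neq0 u1 u2; have [cv1 cv2] := other_neq0 v1 v2.
have fc := hG fA h.
have eu : a + u - a = u by rewrite addrC addKr.
have ev : a + v - a = v by rewrite addrC addKr.
have euv : a + u + v - (a + u) = v by rewrite addrC addKr.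
have evu : a + u + v - (a + v) = u by ring.
rewrite !edge_map_other ?eu ?ev ?euv ?evu //.
move: fc; move: (G a) (G (a + u)) (G (a + v)) (G (a + u + v)) => g1 g2 g3 g4 fc.
apply/eqP; rewrite -subr_eq0; apply/eqP.
rewrite -[RHS](scaler0 _ (- ((e - u) * (e - v))^-1)) -fc.
module_eq ltac:(by field; rewrite ?cu1 ?cv1).
Qed.

(* Inside a strip f is a global section of edge_map, but the section depends on
   the level: it is the one taking the forced values on the upper track. *)
Lemma inversion_exists : exists f : C -> V, forall a b, edge L a b ->
  (e + (b - a)) *: f a - (e - (b - a)) *: f b = G b - G a.
Proof.
have [sg hsg] := jumps_exist.
(* The section for the strip of level k, fixed by one forced value on its upper track; [forced_step]
   then yields the forced values on the whole track. *)
have level (k : int) : exists H : C -> V, (forall a b, edge L a b -> H b = edge_map sg a b (H a)) /\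
    forall P, tie_base P -> n P = k -> H P = forced P.
  have [[P0 tP0 nP0]|none] := pselect (exists2 P, tie_base P & n P = k); last first.
    have [H _ hH] := sections_exist 0 hsg v0; exists H; split=> // P tP nP.
    by case: none; exists P.
  have [H H0 hH] := sections_exist (forced P0) hsg (edge_vertex tP0).
  exists H; split=> // P tP nP.
  have [x x0 hx] := orbit_exists tP0.
  have [|j ->] := same_level_same_orbit e_unit nE hx tP; first by rewrite x0 nP.
  move: j; apply: int_induction; first by rewrite x0.
    move=> j IH; have hs := hx j; have [c1 c2] := tie_step_neq hs; case: (hs) => A hA.
    have [_ s2 _ _] := tie_face_corners hA; case: hA => fA [_ _ vn vN _] _.
    rewrite (hH (x j)); last by exists A.
    by rewrite edge_map_other// IH -forced_step// scalerA mulVf// scale1r.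
  move=> j IH; have hs := hx j; have [c1 c2] := tie_step_neq hs; case: (hs) => A hA.
  have [_ s2 _ _] := tie_face_corners hA; case: hA => fA [_ _ vn vN _] _.
  have E : edge L (x j) (x (j + 1)) by exists A.
  rewrite (hH _ _ (edge_sym E)) IH.
  have -> : forced (x (j + 1)) = edge_map sg (x j) (x (j + 1)) (forced (x j)).
    by rewrite edge_map_other// -forced_step// scalerA mulVf// scale1r.
  exact: edge_mapK.
have [H hH] := choice level.
(* Across a tie the section changes, but the equation there involves the lower value only; along any
   other edge the level, hence the section, is constant. *)
exists (fun z => H (n z) z) => a b hab.
have [ha ta] := hH (n a); have [hb tb] := hH (n b).
have e2 := dir2_neq0; have nab := nE hab.
have [E|/eqP h1] := eqVneq (b - a) e.
  have tA : tie_base a by rewrite /tie_base -E addrC subrK.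
  rewrite ta // E subrr scale0r subr0 /forced -[a + e]/(a + e).
  have -> : a + e = b by rewrite -E addrC subrK.
  by rewrite scalerA -mulr2n -[e *+ 2]mulr_natl mulfV// scale1r.
have [E|/eqP h2] := eqVneq (b - a) (- e).
  have tB : tie_base b.
    by rewrite /tie_base -[e]opprK -E opprB addrC subrK; exact: edge_sym.
  rewrite tb // E subrr scale0r sub0r opprK /forced.
  have -> : b + e = a by rewrite -[e]opprK -E opprB addrC subrK.
  by rewrite scalerA -mulr2n -[e *+ 2]mulr_natl mulfV// scale1r opprB.
have [c1 c2] := other_neq0 h1 h2.
rewrite nab crossing0 // addr0 (ha a b hab) edge_map_other // scalerA mulfV// scale1r.
by rewrite opprB addrC subrK.
Qed.

Hypothesis hL : coherent_tracks_on_both_sides L.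
Hypothesis he : edge_directions L e.

Lemma inversion_unique (f g : C -> V) :
  (forall a b, edge L a b -> (e + (b - a)) *: f a - (e - (b - a)) *: f b = G b - G a) ->
  (forall a b, edge L a b -> (e + (b - a)) *: g a - (e - (b - a)) *: g b = G b - G a) ->
  forall z, vertices L z -> f z = g z.
Proof.
move=> hf hg; apply: (reach_tie e_unit nE hL he) => [P tP|a b hab h1 h2 E].
  have := hf _ _ tP; rewrite -(hg _ _ tP) [P + e - P]addrC addKr subrr !scale0r !subr0.
  rewrite -mulr2n -[e *+ 2]mulr_natl => /(congr1 (fun y => (2 * e)^-1 *: y)).
  by rewrite !scalerA mulVf ?dir2_neq0// !scale1r.
have [c1 c2] := other_neq0 h1 h2.
have := hf _ _ hab; rewrite -(hg _ _ hab) E => /addrI /oppr_inj.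
move=> /(congr1 (fun y => (e - (b - a))^-1 *: y)).
by rewrite !scalerA mulVf// !scale1r.
Qed.

End Inversion.

(** * The backward shift and its resolvent as edge equations *)

Section BackwardShift.
Variables (R : realType) (L : rhombic_lattice R).
Local Notation C := R[i].
Local Notation vert := (vertices L).
Variable h0 : vertices L 0.
Local Notation o := (origin h0).

Lemma level_exists e : `|e| = 1 -> exists n : C -> int, forall a b, edge L a b ->
  n b = n a + crossing e (b - a).
Proof.
move=> e1.
have [||n _ hn] := @monodromy R L int (fun a b k => k + crossing e (b - a)) 0 0 _ _ h0.
- by move=> a b k _; rewrite -[a - b]opprB (crossingN e1) addrK.
- move=> A fA; have [a [u [v h]]] := faces_rhombus fA; exists a, u, v; split=> // k.
  rewrite (_ : a + u - a = u); last by ring.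
  rewrite (_ : a + v - a = v); last by ring.
  rewrite (_ : a + u + v - (a + u) = v); last by ring.
  rewrite (_ : a + u + v - (a + v) = u); last by ring.
  exact: addrAC.
- by exists n.
Qed.

Section Values.
Variables (V : lmodType C) (hL : coherent_tracks_on_both_sides L).
Implicit Types (f g h G : vert -> V) (x y : vert) (e t : C).

Lemma edge_direction x y : edge L (val x) (val y) -> edge_directions L (val y - val x).
Proof. by move=> h; exists (val x), (val y). Qed.

Lemma direction_unit e : edge_directions L e -> `|e| = 1.
Proof. by move=> [a [b [h ->]]]; exact: edge_unit h. Qed.

Definition solves e G f := forall x y, edge L (val x) (val y) ->
  (e + (val y - val x)) *: f x - (e - (val y - val x)) *: f y = G y - G x.

(** The equation itself says that (G + e f)/2 is a primitive of f. *)
Lemma solves_DA e G f : solves e G f -> DA L V f.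
Proof.
move=> hf; apply: (@primitive_DA _ _ _ _ (fun x => 2^-1 *: (G x + e *: f x))) => x y hxy.
transitivity (2^-1 *: (G y - G x + e *: (f y - f x))); first by module_eq ltac:(ring).
by rewrite -hf//; module_eq ltac:(ring).
Qed.

Lemma solves_exists e G : edge_directions L e -> DA L V G -> exists f, solves e G f.
Proof.
move=> he /DA_face_closed hG; have e1 := direction_unit he.
have [n nE] := level_exists e1.
have [f hf] := inversion_exists e1 nE hG h0.
by exists (fun x => f (val x)) => x y /hf ->; rewrite !extend_val.
Qed.

Lemma solves_unique e G f g : edge_directions L e -> solves e G f -> solves e G g -> f = g.
Proof.
move=> he hf hg; have e1 := direction_unit he.
have [n nE] := level_exists e1.
have ext k : solves e G k -> forall a b, edge L a b ->
    (e + (b - a)) *: extend k a - (e - (b - a)) *: extend k b = extend G b - extend G a.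
  move=> hk a b hab; have va := edge_vertex hab; have vb := edge_vertex (edge_sym hab).
  by rewrite !(extend_vertex _ va) !(extend_vertex _ vb); exact: (hk (vertex va) (vertex vb) hab).
apply/funext => x; rewrite -(extend_val f x) -(extend_val g x).
exact: (inversion_unique e1 nE hL he (ext f hf) (ext g hg) (vertexP x)).
Qed.

Hypothesis h1 : edge_directions L 1.

Lemma Zplus_solves h g : DA L V h -> Zplus h0 h = (fun z => g z - g o) <->
  solves 1 (fun x => 2 *: g x) h.
Proof.
move=> hh; split=> [E x y hxy|hs].
  have [_ /(_ x y hxy)] := Zplus_stepP h0 hh; rewrite E => st.
  transitivity (2 *: (g y - g o - (g x - g o))); first last.
    by move: (g x) (g y) (g o) => *; module_eq ltac:(ring).
  by rewrite st; move: (h x) (h y) => *; module_eq ltac:(by field).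
apply: Zplus_eq => //; first by rewrite subrr.
move=> x y hxy; rewrite hs//.
by move: (g x) (g y) (g o) => *; module_eq ltac:(by field).
Qed.

(** Existence of a solution guarantees that [xget] returns a genuine preimage instead of its
    default; uniqueness identifies it. *)
Lemma Zminus_solves g h : DA L V g -> Zminus h0 g = h <-> solves 1 (fun x => 2 *: g x) h.
Proof.
move=> hg.
have dg := DA_scale 2 hg.
have spec : solves 1 (fun x => 2 *: g x) (Zminus h0 g).
  rewrite /Zminus; case: xgetP => [k _ [dk /(Zplus_solves g dk)]//|none].
  have [k hk] := solves_exists h1 dg.
  by case: (none k); split; [exact: solves_DA hk|apply/(Zplus_solves g (solves_DA hk))].
split=> [<-//|hs]; exact: solves_unique h1 spec hs.
Qed.

Lemma Zminus_DA g : DA L V g -> DA L V (Zminus h0 g).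
Proof. by move=> hg; apply: solves_DA ((Zminus_solves _ hg).1 erefl). Qed.

Lemma resolvent_solves t e f g : 2 + t * (1 - e) = 0 -> DA L V f -> DA L V g ->
  (fun x => t *: f x - Zminus h0 f x) = g <-> solves e (fun x => (2 / t) *: Zplus h0 g x) f.
Proof.
move=> te df dg.
have t0 : t != 0.
  by apply: contra_eq_neq te => ->; rewrite mul0r addr0 pnatr_eq0.
(* So e = 1 + 2/t, and the equation for direction e is that of [Zminus], with t f - g as value,
   divided by t. *)
have E2 : 2 = t * (e - 1) by apply/eqP; rewrite -subr_eq0 -te; apply/eqP; ring.
have [_ st] := Zplus_stepP h0 dg.
have -> : (fun x => t *: f x - Zminus h0 f x) = g <->
    Zminus h0 f = (fun x => t *: f x - g x).
  split=> [<-|->]; apply/funext => x; by rewrite subKr.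
apply: iff_trans (Zminus_solves _ df) _.
split=> hs x y hxy.
  have := hs x y hxy; have := st x y hxy.
  move: (f x) (f y) (g x) (g y) (Zplus _ _ x) (Zplus _ _ y) (val y - val x).
  move=> f1 f2 g1 g2 z1 z2 d e1 e2.
  transitivity ((2 / t) *: (z2 - z1)); last by module_eq ltac:(ring).
  apply/eqP; rewrite e1 -subr_eq0; apply/eqP.
  transitivity (t^-1 *: ((1 + d) *: (t *: f1 - g1) - (1 - d) *: (t *: f2 - g2)
     - (2 *: f2 - 2 *: f1))); last by rewrite e2 subrr scaler0.
  have -> : e = 1 + 2 / t by rewrite {1}E2; field.
  module_eq ltac:(by field; rewrite ?t0).
have := hs x y hxy; have := st x y hxy.
move: (f x) (f y) (g x) (g y) (Zplus _ _ x) (Zplus _ _ y) (val y - val x).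
move=> f1 f2 g1 g2 z1 z2 d e1 e2.
apply/eqP; rewrite -subr_eq0; apply/eqP.
transitivity (t *: ((e + d) *: f1 - (e - d) *: f2 - (2 / t) *: (2^-1 *: ((1 + d) *: g1 - (1 - d) *: g2)))).
  have -> : e = 1 + 2 / t by rewrite {1}E2; field.
  module_eq ltac:(by field; rewrite ?t0).
by rewrite e2 -e1 -scalerBr subrr scaler0.
Qed.

End Values.

(** * The eigenfunctions at regular points t *)

Section Exponential.
Hypothesis hL : coherent_tracks_on_both_sides L.
Hypothesis h1 : edge_directions L 1.
Variable t : C.
Hypothesis ht : ~ singular_set L t.
Implicit Types (f g : vert -> C^o) (x y : vert).

Definition exp_relation f := forall x y, edge L (val x) (val y) ->
  (2 + t * (1 + (val y - val x))) * f x = (2 + t * (1 - (val y - val x))) * f y.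

Lemma regular_neq0 d : edge_directions L d -> 2 + t * (1 - d) != 0.
Proof. by move=> hd; apply/eqP => E; apply: ht; exists d. Qed.

Lemma exp_relation_DA f : exp_relation f -> DA L C^o f.
Proof.
(* For t = 0 the relation makes f constant, with primitive z f; the primitive (2 + t)/(2 t) f serves
   only for t different from 0. *)
move=> hf; have [t0|t0] := eqVneq t 0.
  apply: (@primitive_DA _ _ _ _ (fun x => val x * f x : C^o)) => x y /hf.
  rewrite t0 !mul0r !addr0 => /(mulfI (_ : 2 != 0)) -> //; rewrite ?pnatr_eq0//.
  by rewrite /GRing.scale /=; field.
apply: (@primitive_DA _ _ _ _ (fun x => (2 + t) / (2 * t) * f x : C^o)) => x y /hf.
rewrite /GRing.scale /= /GRing.scale /=; move: (val y - val x) => d E.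
apply/eqP; rewrite -subr_eq0; apply/eqP.
transitivity ((2 * t)^-1 * ((2 + t * (1 - d)) * f y - (2 + t * (1 + d)) * f x)).
  by field; rewrite t0.
by rewrite E subrr mulr0.
Qed.

Lemma exp_relation_eq f g : exp_relation f -> exp_relation g -> f o = g o -> f = g.
Proof.
move=> hf hg E; apply: (eq_by_edges E) => x y hxy exy.
apply: (mulfI (regular_neq0 (edge_direction hxy))).
by rewrite -hf// -hg// exy.
Qed.

Lemma eigen_relation f : DA L C^o f -> Zminus h0 f = t *: f <-> exp_relation f.
Proof.
move=> df; apply: iff_trans (Zminus_solves hL h1 _ df) _; split=> hs x y hxy.
  have := hs x y hxy; rewrite /GRing.scale /=; move: (val y - val x) => d E.
  apply/eqP; rewrite -subr_eq0; apply/eqP.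
  transitivity ((1 + d) * (t * f x) - (1 - d) * (t * f y) - (2 * f y - 2 * f x)); first by ring.
  by rewrite E subrr.
have := hs x y hxy; rewrite /GRing.scale /= /GRing.scale /=; move: (val y - val x) => d E.
apply/eqP; rewrite -subr_eq0; apply/eqP.
transitivity ((2 + t * (1 + d)) * f x - (2 + t * (1 - d)) * f y); first by ring.
by rewrite E subrr.
Qed.

Lemma exp_relation_exists : exists2 f, exp_relation f & f o = 1.
Proof.
have neq a b : edge L a b -> 2 + t * (1 - (b - a)) != 0.
  by move=> hab; apply: regular_neq0; exists a, b.
(* Edge directions are closed under negation, so the numerators do not vanish either. *)
have neqN a b : edge L a b -> 2 + t * (1 + (b - a)) != 0.
  by move=> /edge_sym/neq; rewrite -[b - a]opprB.
have [||f f1 hf] := @monodromy R L C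
  (fun a b w => (2 + t * (1 + (b - a))) / (2 + t * (1 - (b - a))) * w) 0 1 _ _ h0.
- move=> a b x hab; have c1 := neq _ _ hab; have c2 := neqN _ _ hab.
  by rewrite -[a - b]opprB; move: (b - a) c1 c2 => d c1 c2; field; rewrite opprK ?c1 ?c2.
- move=> A fA; have [a [u [v h]]] := faces_rhombus fA; exists a, u, v; split=> // x.
  rewrite (_ : a + u - a = u); last by ring.
  rewrite (_ : a + v - a = v); last by ring.
  rewrite (_ : a + u + v - (a + u) = v); last by ring.
  rewrite (_ : a + u + v - (a + v) = u); last by ring.
  by rewrite mulrCA.
exists (fun x => f (val x)) => // x y hxy.
by rewrite (hf _ _ hxy) mulrA mulrCA mulfV ?mulr1 ?neq.
Qed.

Lemma exp_relation_path f a b N z : exp_relation f -> path_from_to a b N z ->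
  f b = f a * exp_product t N z.
Proof.
move=> hf [<- <- hz].
have : forall k, (k <= N)%N -> f (z k) = f (z 0%N) * exp_product t k z.
  elim=> [|k IH] kN; first by rewrite /exp_product big_ord0 mulr1.
  have hk := hz k kN; have c := regular_neq0 (edge_direction hk).
  have {}hf := hf _ _ hk; have IHk := IH (ltnW kN).
  rewrite /exp_product big_ord_recr /= [LHS](_ : _ = f (z k) *
    ((2 + t * (1 + val (z k.+1) - val (z k))) / (2 + t * (1 + val (z k) - val (z k.+1))))).
    by rewrite IHk -mulrA.
  have -> : 1 + val (z k.+1) - val (z k) = 1 + (val (z k.+1) - val (z k)) by ring.
  have -> : 1 + val (z k) - val (z k.+1) = 1 - (val (z k.+1) - val (z k)) by ring.
  by rewrite mulrA [f _ * _]mulrC hf mulrC mulKf.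
exact.
Qed.

End Exponential.
End BackwardShift.

Theorem theorem2p1 (R : realType) (L : rhombic_lattice R)
    (h0 : vertices L 0) (h1 : edge_directions L 1)
    (hL : coherent_tracks_on_both_sides L) :
  (forall t : R[i], ~ singular_set L t ->
     [/\ Zminus_eigenvalue R[i]^o h0 t,
         one_dimensional (Zminus_eigenspace R[i]^o h0 t)
       & exists e : vertices L -> R[i]^o,
           [/\ unique (discrete_exp h0 t) e,
               DA L R[i]^o e
             & Zminus_eigenspace R[i]^o h0 t = span1 e]])
  /\
  (forall (V : lmodType R[i]) (t : R[i]), singular_set L t ->
     set_bij (DA L V) (DA L V) (fun f => t *: f - Zminus h0 f)).
Proof.
split=> [t ht|V t [e he te]].
  have [E hE E1] := exp_relation_exists h0 ht.
  have dE := exp_relation_DA hE.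
  have En0 : E <> 0 by move=> E0; move/eqP: E1; rewrite E0 eq_sym oner_eq0.
  have space : Zminus_eigenspace R[i]^o h0 t = span1 E.
    apply/seteqP; split=> f.
      move=> [df /(eigen_relation h0 hL h1 t df) hf]; exists (f (origin h0)).
      apply: (exp_relation_eq ht hf); last first.
        by rewrite -[RHS]/(f (origin h0) * E (origin h0)) E1 mulr1.
      move=> x y hxy; rewrite /GRing.scale /=.
      by rewrite mulrCA (hE _ _ hxy) mulrCA.
    move=> [c ->].
    have hc : exp_relation t (c *: E).
      by move=> x y hxy; rewrite /GRing.scale /= mulrCA (hE _ _ hxy) mulrCA.
    by split; [exact: exp_relation_DA hc|apply/(eigen_relation h0 hL h1 t (exp_relation_DA hc))].
  split.
  - exists E => //; rewrite space; exists 1; by rewrite scale1r.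
  - by exists E.
  - exists E; split=> //; split.
      split=> // x N z _ hz.
      by rewrite (exp_relation_path ht hE hz) E1 mul1r.
    move=> E' [E'1 hE']; apply/funext => x.
    (* [discrete_exp] fixes the value at the origin separately and prescribes the product only
       elsewhere. *)
    have [x0|x0] := pselect (val x = 0).
      have -> : x = origin h0 by exact: val_inj.
      by rewrite E1 E'1.
    have [N [z hz]] := path_exists (origin h0) x.
    by rewrite (hE' x N z) // (exp_relation_path ht hE hz) E1 mul1r.
have res f g := @resolvent_solves R L h0 V hL h1 t e f g te.
split.
- move=> f df /=; have := DA_lin (-1) (Zminus_DA h0 hL h1 df) (DA_scale t df).
  by congr (DA L V _); apply/funext => x; rewrite scaleN1r addrC.
- move=> f g /set_mem df /set_mem dg E.
  have dw := DA_lin (-1) (Zminus_DA h0 hL h1 df) (DA_scale t df).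
  have {}dw : DA L V (fun x => t *: f x - Zminus h0 f x).
    by move: dw; congr (DA L V _); apply/funext => x; rewrite scaleN1r addrC.
  have sf := (res f _ df dw).1 erefl.
  have sg := (res g _ dg dw).1 (esym E).
  by have := solves_unique h0 hL he sf sg.
(* A preimage of g comes from the edge equation with right-hand side (2/t) Z_+ g; its solution is
   automatically DA. *)
- move=> g dg; have dZ := DA_scale (2 / t) (Zplus_DA h0 dg).
  have [f hf] := solves_exists h0 he dZ.
  have df := solves_DA hf; exists f => //.
  exact: (res f g df dg).2 hf.
Qed.
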